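(* Let $n>1$ be an integer, let $0\neq\mu=\sum_{i=1}^n\mu_i\varepsilon_i\in\Lambda^+$ with $\mathcal{S}(\mu)=\{n_0,n_1,\dots,n_s\}$, and define $$\Theta(\mu)=\begin{cases}\mu_1+n-1-\mathbb{N}&\text{if }\mu_{n-1}=-\mu_n>0\text{ and }s=2,\\ \mu_1+2n-n_1-1-\mathbb{N}&\text{otherwise.}\end{cases}$$ Then the generalized conformal $o(2n+2,\mathbb{C})$-module $\widehat{V(\mu)}$ with constant $b$ is irreducible if $$b\in\mathbb{C}\setminus\Big(\big(n-1-\tfrac12\mathbb{N}\big)\cup\Theta(\mu)\Big).$$
   Context: $\mathbb{N}=\{0,1,2,\dots\}$; for $c\in\mathbb C$, $c-\mathbb{N}=\{c-k:k\in\mathbb{N}\}$ and $c-\frac12\mathbb{N}=\{c-k/2:k\in\mathbb{N}\}$. $E_{r,s}$ denotes the matrix with $1$ in entry $(r,s)$ and $0$ elsewhere. Let $I=\{1,\dots,2n\}$ with involution $i'=n+i$, $(n+i)'=i$ for $1\le i\le n$. $o(2n,\mathbb{C})$ is the span of $F_{i,j}=E_{i,j}-E_{j',i'}$ ($i,j\in I$). $o(2n+2,\mathbb{C})$ is the span of $\hat F_{r,s}=E_{r,s}-E_{s^*,r^*}$ for $r,s\in\{1,\dots,2n+2\}$, where $i^*=n+1+i$, $(n+1+i)^*=i$ for $1\le i\le n+1$. Weights. The Cartan subalgebra of $o(2n,\mathbb{C})$ is $\sum_{i=1}^n\mathbb{C}F_{i,i}$, $\varepsilon_i(F_{j,j})=\delta_{i,j}$,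 the positive roots are $\varepsilon_i\pm\varepsilon_j$ ($1\le i<j\le n$), and the dominant integral weights are $\Lambda^+=\{\sum_{i=1}^n\mu_i\varepsilon_i:\mu_i\in\frac12\mathbb{Z},\ \mu_i-\mu_{i+1}\in\mathbb{N}\ (1\le i\le n-1),\ \mu_{n-1}+\mu_n\in\mathbb{N}\}$. $V(\mu)$ is the finite-dimensional irreducible $o(2n,\mathbb{C})$-module of highest weight $\mu$. For $\mu\in\Lambda^+$, $\mathcal{S}(\mu)=\{n_0,n_1,\dots,n_s\}$ is the unique sequence $0=n_0<n_1<\cdots<n_s=n$ such that $\mu_i=\mu_j$ if and only if $n_r<i,j\le n_{r+1}$ for some $r\in\{0,\dots,s-1\}$. Conformal operators. Let $\mathcal{A}=\mathbb{C}[x_1,\dots,x_{2n}]$, $\partial_i=\partial_{x_i}$, $\eta=\sum_{i=1}^nx_ix_{n+i}$, and for $i,j\in I$ $$D=\sum_{r\in I}x_r\partial_r,\qquad J_i=x_iD-\eta\,\partial_{i'},\qquad L_{i,j}=x_i\partial_j-x_{j'}\partial_{i'}.$$ The span $\mathcal{C}_{2n}$ of $D$ and all $\partial_i,J_i,L_{i,j}$ is a Lie algebra, and with $\kappa(i)=i$, $\kappa(n+i)=n+1+i$ ($1\le i\le n$) there is a Lie algebra isomorphism $\vartheta:o(2n+2,\mathbb{C})\to\mathcal{C}_{2n}$ given by $\vartheta(\hat F_{\kappa(i),\kappa(j)})=L_{i,j}$, $\vartheta(\hat F_{n+1,n+1})=-D$, $\vartheta(\hat F_{n+1,\kappa(i)})=\partial_i$,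 $\vartheta(\hat F_{\kappa(i),n+1})=-J_i$. Generalized conformal module. For an $o(2n,\mathbb{C})$-module $M$ and $b\in\mathbb{C}$, $\widehat M=\mathcal{A}\otimes_{\mathbb{C}}M$ is a $\mathcal{C}_{2n}$-module via, for $g\in\mathcal{A}$, $v\in M$, $$\partial_i(g\otimes v)=\partial_i(g)\otimes v,\quad D(g\otimes v)=(D(g)+bg)\otimes v,\quad L_{i,j}(g\otimes v)=L_{i,j}(g)\otimes v+g\otimes F_{i,j}(v),$$ $$J_i(g\otimes v)=\big(J_i(g)+b\,x_ig\big)\otimes v+\sum_{p\in I}x_pg\otimes F_{i,p}(v),$$ and it becomes an $o(2n+2,\mathbb{C})$-module by letting $A\in o(2n+2,\mathbb{C})$ act as $\vartheta(A)$. *)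

(* Defs.v *)
From HB Require Import structures.
From mathcomp Require Import all_boot all_order all_algebra.
From mathcomp Require Export reals complex.
From mathcomp Require Export mpoly.

Set Implicit Arguments.
Unset Strict Implicit.
Unset Printing Implicit Defensive.

Import Order.TTheory GRing.Theory Num.Theory.
Local Open Scope ring_scope.

(** * The orthogonal Lie algebras o(2m, C)

    The index set {1, ..., 2m} is ['I_(m + m)], counted from 0: [lshift m i]
    stands for i and [rshift m i] for m + i. *)

Definition flip m (i : 'I_(m + m)) : 'I_(m + m) :=
  match split i with inl a => rshift m a | inr a => lshift m a end.

Definition Fmx (C : numFieldType) m (i j : 'I_(m + m)) : 'M[C]_(m + m) :=
  delta_mx i j - delta_mx (flip j) (flip i).

Definition so2 (C : numFieldType) m : {vspace 'M[C]_(m + m)} :=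
  <<[seq Fmx C i j | i <- enum 'I_(m + m), j <- enum 'I_(m + m)]>>%VS.

Definition lie (C : numFieldType) m (A B : 'M[C]_m) : 'M[C]_m :=
  A *m B - B *m A.

(** * Modules over a Lie algebra of matrices

    The action is a function of all matrices, of which only the values on [L]
    are relevant. *)

Record lie_module (C : numFieldType) m (L : {vspace 'M[C]_m})
    (W : lmodType C) (act : 'M[C]_m -> W -> W) : Prop := LieModule {
  act_linear : forall A, A \in L -> linear (act A);
  act_linearl : forall a A B w, A \in L -> B \in L ->
    act (a *: A + B) w = a *: act A w + act B w;
  act_lie : forall A B w, A \in L -> B \in L ->
    act (lie A B) w = act A (act B w) - act B (act A w)
}.

Definition submodule (C : numFieldType) m (L : {vspace 'M[C]_m})
    (W : lmodType C) (act : 'M[C]_m -> W -> W) (U : W -> Prop) : Prop :=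
  [/\ U 0,
      forall a u v, U u -> U v -> U (a *: u + v) &
      forall A u, A \in L -> U u -> U (act A u)].

Definition irreducible_module (C : numFieldType) m (L : {vspace 'M[C]_m})
    (W : lmodType C) (act : 'M[C]_m -> W -> W) : Prop :=
  [/\ lie_module L act,
      exists w : W, w != 0 &
      forall U, submodule L act U ->
        (forall w, U w -> w = 0) \/ (forall w, U w)].

(** * Weights of o(2n, C)

    A weight is given by its values on the basis [Hmx C k] of the Cartan
    subalgebra.  The tuple [mu] stands for \sum_i mu_i eps_i, so that mu_i is
    [mu`_i.-1]. *)

Definition Hmx (C : numFieldType) n (k : 'I_n) : 'M[C]_(n + n) :=
  Fmx C (lshift n k) (lshift n k).

Definition eps (C : numFieldType) n (i : 'I_n) : {ffun 'I_n -> C} :=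
  [ffun k => (i == k)%:R].

Definition positive_root (C : numFieldType) n (alpha : {ffun 'I_n -> C}) :=
  exists i j : 'I_n, (i < j)%N /\
    (alpha = eps C i + eps C j \/ alpha = eps C i - eps C j).

Definition root_vector (C : numFieldType) n (alpha : {ffun 'I_n -> C})
    (X : 'M[C]_(n + n)) : Prop :=
  X \in so2 C n /\ forall k, lie (Hmx C k) X = alpha k *: X.

Definition has_highest_weight (C : numFieldType) n (V : lmodType C)
    (act : 'M[C]_(n + n) -> V -> V) (mu : n.-tuple C) : Prop :=
  exists v : V, [/\ v != 0,
    forall k : 'I_n, act (Hmx C k) v = mu`_k *: v &
    forall alpha X, positive_root alpha -> root_vector alpha X -> act X v = 0].

(** [simple_highest_weight_module act mu] says that V is V(mu): since V is a
    [vectType], it is finite-dimensional. *)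
Definition simple_highest_weight_module (C : numFieldType) n (V : vectType C)
    (act : 'M[C]_(n + n) -> V -> V) (mu : n.-tuple C) : Prop :=
  irreducible_module (so2 C n) act /\ has_highest_weight act mu.

Definition dominant_integral (C : numFieldType) n (mu : n.-tuple C) : Prop :=
  [/\ forall i, (i < n)%N -> exists m : int, mu`_i = m%:~R / 2,
      forall i, (i.+1 < n)%N -> exists k : nat, mu`_i - mu`_i.+1 = k%:R &
      exists k : nat, mu`_n.-2 + mu`_n.-1 = k%:R].

(** The sequence 0 = n_0 < ... < n_s = n of S(mu).  As i and j are counted from
    0, the condition n_r < i <= n_(r+1) becomes n_r <= i < n_(r+1). *)
Definition level_sequence (C : numFieldType) n (mu : n.-tuple C) s
    (ns : s.+1.-tuple nat) : Prop :=
  [/\ nth 0 ns 0 = 0, nth 0 ns s = n, sorted ltn ns &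
      forall i j, i < n -> j < n ->
        (mu`_i = mu`_j)%R <->
        exists r, [/\ r < s, nth 0 ns r <= i < nth 0 ns r.+1 &
                      nth 0 ns r <= j < nth 0 ns r.+1]]%N.

(** The sets c - N, c - 1/2 N and Theta(mu) are predicates on C. *)
Definition minusN (C : numFieldType) (c b : C) : Prop :=
  exists k : nat, b = c - k%:R.

Definition minus_halfN (C : numFieldType) (c b : C) : Prop :=
  exists k : nat, b = c - k%:R / 2.

Definition Theta (C : numFieldType) n (mu : n.-tuple C) s
    (ns : s.+1.-tuple nat) : C -> Prop :=
  if [&& mu`_n.-2 == - mu`_n.-1, 0 < - mu`_n.-1 & s == 2%N]
  then minusN (mu`_0 + n%:R - 1)
  else minusN (mu`_0 + (2 * n)%:R - (nth 0%N ns 1)%:R - 1).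

(** * Conformal operators on C[x_1, ..., x_2n] *)

Definition eta (C : numFieldType) n : {mpoly C[n + n]} :=
  \sum_(i < n) 'X_(lshift n i) * 'X_(rshift n i).

Definition opD (C : numFieldType) n (g : {mpoly C[n + n]}) :
    {mpoly C[n + n]} :=
  \sum_r 'X_r * g^`M(r).

Definition opJ (C : numFieldType) n (i : 'I_(n + n)) (g : {mpoly C[n + n]}) :
    {mpoly C[n + n]} :=
  'X_i * opD g - eta C n * g^`M(flip i).

Definition opL (C : numFieldType) n (i j : 'I_(n + n))
    (g : {mpoly C[n + n]}) : {mpoly C[n + n]} :=
  'X_i * g^`M(j) - 'X_(flip j) * g^`M(flip i).

(** * The tensor product of C[x_1, ..., x_m] with a finite-dimensional space V

    An element is the family of its coordinates, in C[x_1, ..., x_m], along a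
    basis of V.  [pure_bilinear] and [tensor_universal] show that this is the
    tensor product. *)

Definition tensor (C : numFieldType) m (V : vectType C) : Type :=
  {ffun 'I_(\dim {: V}) -> {mpoly C[m]}}.

HB.instance Definition _ (C : numFieldType) m (V : vectType C) :=
  GRing.Lmodule.on (tensor m V).

Definition pure (C : numFieldType) m (V : vectType C)
    (g : {mpoly C[m]}) (v : V) : tensor m V :=
  [ffun k => coord (vbasis {: V}) k v *: g].

(** The operator T (x) S, for T and S linear; see [tens_op_pure]. *)
Definition tens_op (C : numFieldType) m (V : vectType C)
    (T : {mpoly C[m]} -> {mpoly C[m]}) (S : V -> V) (w : tensor m V) :
    tensor m V :=
  \sum_k pure (T (w k)) (S (vbasis {: V})`_k).

Section TensorFacts.

Context (C : numFieldType) (m : nat) (V : vectType C).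

Implicit Types (g : {mpoly C[m]}) (v : V) (w : tensor m V).

Lemma pure_bilinear :
  (forall v, linear (fun g => pure g v)) /\
  (forall g, linear (pure g : V -> tensor m V)).
Proof.
split=> [v a g h|g a u v]; apply/ffunP=> k; rewrite !ffunE.
  by rewrite scalerDr !scalerA [a * _]mulrC.
by rewrite linearP scalerDl scalerA.
Qed.

Lemma pure_basis (g : {mpoly C[m]}) (k l : 'I_(\dim {: V})) :
  (pure g (vbasis {: V})`_k : tensor m V) l = (k == l)%:R *: g.
Proof.
rewrite ffunE coord_free ?(basis_free (vbasisP _)) //.
Qed.

Lemma tensor_sum_pure w : w = \sum_k pure (w k) (vbasis {: V})`_k.
Proof.
apply/ffunP=> l; rewrite sum_ffunE (bigD1 l) //= pure_basis eqxx scale1r.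
by rewrite big1 ?addr0 // => k ne; rewrite pure_basis (negbTE ne) scale0r.
Qed.

Lemma linear_sumZ (U W : lmodType C) (f : U -> W) (I : finType)
    (a : I -> C) (u : I -> U) : linear f ->
  f (\sum_i a i *: u i) = \sum_i a i *: f (u i).
Proof.
move=> lf; have f0 : f 0 = 0.
  by have := lf (-1) 0 0; rewrite scaler0 addr0 scaleN1r addNr.
apply: (big_rec2 (fun x y => f x = y)) => // i x y _ <-.
by rewrite lf.
Qed.

Lemma tensor_universal (U : lmodType C) (f : {mpoly C[m]} -> V -> U) :
  (forall v, linear (f ^~ v)) -> (forall g, linear (f g)) ->
  exists h : tensor m V -> U,
    [/\ linear h, forall g v, h (pure g v) = f g v &
        forall h' : tensor m V -> U, linear h' ->
          (forall g v, h' (pure g v) = f g v) -> h' =1 h].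
Proof.
move=> fl fr; exists (fun w => \sum_k f (w k) (vbasis {: V})`_k); split.
- move=> a u w; rewrite scaler_sumr -big_split /=; apply: eq_bigr => k _.
  by rewrite !ffunE fl.
- move=> g v; rewrite {2}(coord_vbasis (memvf v)) linear_sumZ //.
  apply: eq_bigr => k _; rewrite ffunE.
  have := fl (vbasis {: V})`_k (coord (vbasis {: V}) k v) g 0.
  rewrite addr0 => ->; suff -> : f 0 (vbasis {: V})`_k = 0 by rewrite addr0.
  have := fl (vbasis {: V})`_k (-1) 0 0.
  by rewrite scaler0 addr0 scaleN1r addNr.
move=> h' lh' eh' w; rewrite {1}(tensor_sum_pure w).
under eq_bigr do rewrite -[pure _ _]scale1r.
by rewrite linear_sumZ //; apply: eq_bigr => k _; rewrite scale1r eh'.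
Qed.

Lemma tens_op_pure (T : {mpoly C[m]} -> {mpoly C[m]}) (S : V -> V) g v :
  linear T -> linear S -> tens_op T S (pure g v) = pure (T g) (S v).
Proof.
move=> lT lS; rewrite /tens_op {2}(coord_vbasis (memvf v)) linear_sumZ //.
rewrite [RHS]linear_sumZ; last exact: pure_bilinear.2.
apply: eq_bigr => k _; rewrite ffunE.
have T0 : T 0 = 0.
  by have := lT (-1) 0 0; rewrite scaler0 addr0 scaleN1r addNr.
rewrite -[_ *: g]addr0 lT T0 addr0.
apply/ffunP=> l; rewrite !ffunE !scalerA mulrC //.
Qed.

End TensorFacts.

(** * The generalized conformal module

    [act] is the action of o(2n, C) on V. *)

Definition conf_d (C : numFieldType) n (V : vectType C) (i : 'I_(n + n))
    (w : tensor (n + n) V) : tensor (n + n) V :=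
  tens_op (mderiv i) id w.

Definition conf_D (C : numFieldType) n (V : vectType C) (b : C)
    (w : tensor (n + n) V) : tensor (n + n) V :=
  tens_op (fun g => opD g + b *: g) id w.

Definition conf_L (C : numFieldType) n (V : vectType C)
    (act : 'M[C]_(n + n) -> V -> V) (i j : 'I_(n + n))
    (w : tensor (n + n) V) : tensor (n + n) V :=
  tens_op (opL i j) id w + tens_op id (act (Fmx C i j)) w.

Definition conf_J (C : numFieldType) n (V : vectType C)
    (act : 'M[C]_(n + n) -> V -> V) (b : C) (i : 'I_(n + n))
    (w : tensor (n + n) V) : tensor (n + n) V :=
  tens_op (fun g => opJ i g + b *: ('X_i * g)) id w
  + \sum_p tens_op (fun g => 'X_p * g) (act (Fmx C i p)) w.

Definition kappa n (i : 'I_(n + n)) : 'I_(n.+1 + n.+1) :=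
  match split i with
  | inl a => lshift n.+1 (widen_ord (leqnSn n) a)
  | inr a => rshift n.+1 (widen_ord (leqnSn n) a)
  end.

(** The index n + 1. *)
Definition pivot n : 'I_(n.+1 + n.+1) := lshift n.+1 (ord_max : 'I_n.+1).

(** The action of A in o(2n+2, C) through theta.  With hatF the spanning
    matrices of o(2n+2, C) and p = n + 1,
      A = 1/2 \sum_(i, j) A_(kappa i, kappa j) hatF_(kappa i, kappa j)
          + A_(p, p) hatF_(p, p) + \sum_i A_(p, kappa i) hatF_(p, kappa i)
          + \sum_i A_(kappa i, p) hatF_(kappa i, p),
    the factor 1/2 being due to hatF_(kappa i, kappa j) =
    - hatF_(kappa j', kappa i').  The values on the spanning matrices are
    [conformal_L], [conformal_D], [conformal_d] and [conformal_J]. *)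
Definition conformal (C : numFieldType) n (V : vectType C)
    (act : 'M[C]_(n + n) -> V -> V) (b : C)
    (A : 'M[C]_(n.+1 + n.+1)) (w : tensor (n + n) V) : tensor (n + n) V :=
  2^-1 *: (\sum_i \sum_j A (kappa i) (kappa j) *: conf_L act i j w)
  - A (pivot n) (pivot n) *: conf_D b w
  + \sum_i A (pivot n) (kappa i) *: conf_d i w
  - \sum_i A (kappa i) (pivot n) *: conf_J act b i w.

Lemma flip_lshift m (a : 'I_m) : flip (lshift m a) = rshift m a.
Proof. by rewrite /flip -[lshift m a]/(unsplit (inl a)) unsplitK. Qed.

Lemma flip_rshift m (a : 'I_m) : flip (rshift m a) = lshift m a.
Proof. by rewrite /flip -[rshift m a]/(unsplit (inr a)) unsplitK. Qed.

Lemma flipK m : involutive (@flip m).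
Proof.
by move=> i; case: (split_ordP i) => a ->; rewrite !(flip_lshift, flip_rshift).
Qed.

Lemma FmxN (C : numFieldType) m (i j : 'I_(m + m)) :
  Fmx C (flip j) (flip i) = - Fmx C i j.
Proof. by rewrite /Fmx !flipK opprB. Qed.

Lemma Fmx_so2 (C : numFieldType) m (i j : 'I_(m + m)) : Fmx C i j \in so2 C m.
Proof. by apply/memv_span/allpairsP; exists (i, j); rewrite !mem_enum. Qed.

Lemma kappa_lshift n (a : 'I_n) :
  kappa (lshift n a) = lshift n.+1 (widen_ord (leqnSn n) a).
Proof. by rewrite /kappa -[lshift n a]/(unsplit (inl a)) unsplitK. Qed.

Lemma kappa_rshift n (a : 'I_n) :
  kappa (rshift n a) = rshift n.+1 (widen_ord (leqnSn n) a).
Proof. by rewrite /kappa -[rshift n a]/(unsplit (inr a)) unsplitK. Qed.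

Lemma val_kappa n (i : 'I_(n + n)) :
  val (kappa i) = (if i < n then val i else i.+1)%N.
Proof.
case: (split_ordP i) => a ->.
  by rewrite kappa_lshift.
by rewrite kappa_rshift.
Qed.

Lemma kappa_inj n : injective (@kappa n).
Proof.
move=> i j /(congr1 val); rewrite /= !val_kappa => e; apply/val_inj => /=.
move: e; case: ltnP => hi; case: ltnP => hj //; last by case.
- by move=> e; move: hi; rewrite e ltnNge (leq_trans hj).
- by move=> e; move: hj; rewrite -e ltnNge (leq_trans hi).
Qed.

Lemma flip_kappa n (i : 'I_(n + n)) : flip (kappa i) = kappa (flip i).
Proof.
case: (split_ordP i) => a ->; rewrite !(flip_lshift, flip_rshift,
  kappa_lshift, kappa_rshift) //.
Qed.

Lemma kappa_pivot n (i : 'I_(n + n)) : (kappa i == pivot n) = false.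
Proof.
apply/negbTE/eqP => /(congr1 val); rewrite /= val_kappa.
case: ltnP => [lt e|le e]; first by rewrite e ltnn in lt.
by move: le; rewrite leqNgt -[X in (_ < X)%N]e ltnSn.
Qed.

Lemma kappa_flip_pivot n (i : 'I_(n + n)) : (kappa i == flip (pivot n)) = false.
Proof.
rewrite -[kappa i]flipK (inj_eq (can_inj (@flipK _))) flip_kappa.
exact: kappa_pivot.
Qed.

Lemma flip_pivot_neq n : (flip (pivot n) == pivot n) = false.
Proof.
apply/negbTE/eqP; rewrite flip_lshift => /(congr1 val) /= e.
by have := leq_addr n n.+1; rewrite e ltnn.
Qed.

Lemma opD_linear (C : numFieldType) n : linear (@opD C n).
Proof.
move=> a g h; rewrite /opD scaler_sumr -big_split; apply: eq_bigr => r _ /=.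
by rewrite linearP mulrDr -scalerAr.
Qed.

Lemma opL_linear (C : numFieldType) n i j : linear (@opL C n i j).
Proof.
move=> a g h; rewrite /opL !linearP !mulrDr -!scalerAr.
by rewrite scalerBr opprD addrACA.
Qed.

Lemma opJ_linear (C : numFieldType) n i : linear (@opJ C n i).
Proof.
move=> a g h; rewrite /opJ opD_linear linearP !mulrDr -!scalerAr.
by rewrite scalerBr opprD addrACA.
Qed.

Section ConformalFacts.

Context (C : numFieldType) (n : nat) (V : vectType C).
Context (act : 'M[C]_(n + n) -> V -> V) (actP : lie_module (so2 C n) act).
Context (b : C).

Implicit Types (g : {mpoly C[n + n]}) (v : V) (w : tensor (n + n) V).

Lemma conf_d_pure i g v : conf_d i (pure g v) = pure g^`M(i) v.
Proof. by rewrite /conf_d tens_op_pure // => a u w; rewrite linearP. Qed.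

Lemma conf_D_pure g v : conf_D b (pure g v) = pure (opD g + b *: g) v.
Proof.
rewrite /conf_D tens_op_pure // => a u w.
by rewrite opD_linear !scalerDr !scalerA [b * a]mulrC addrACA.
Qed.

Lemma conf_L_pure i j g v :
  conf_L act i j (pure g v) = pure (opL i j g) v + pure g (act (Fmx C i j) v).
Proof.
rewrite /conf_L !tens_op_pure //; last exact: opL_linear.
exact/(act_linear actP)/Fmx_so2.
Qed.

Lemma conf_J_pure i g v :
  conf_J act b i (pure g v) =
  pure (opJ i g + b *: ('X_i * g)) v
  + \sum_p pure ('X_p * g) (act (Fmx C i p) v).
Proof.
rewrite /conf_J tens_op_pure //; last first.
  move=> a u w; rewrite opJ_linear mulrDr -scalerAr.
  by rewrite !scalerDr !scalerA [b * a]mulrC addrACA.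
congr (_ + _); apply: eq_bigr => p _; rewrite tens_op_pure //.
  by move=> a u w; rewrite mulrDr -scalerAr.
exact/(act_linear actP)/Fmx_so2.
Qed.

Lemma conf_LN i j w : conf_L act (flip j) (flip i) w = - conf_L act i j w.
Proof.
have pN g v : pure (- g) v = - pure g v :> tensor (n + n) V.
  by apply/ffunP=> k; rewrite !ffunE scalerN.
have pNr g v : pure g (- v) = - pure g v :> tensor (n + n) V.
  by apply/ffunP=> k; rewrite !ffunE linearN scaleNr.
rewrite /conf_L /tens_op opprD -!sumrN; congr (_ + _); apply: eq_bigr => k _.
  by rewrite -pN /opL !flipK opprB.
rewrite -pNr FmxN; congr pure.
have F0 := mem0v (so2 C n); have Fm := Fmx_so2 C i j.
have a0 v : act 0 v = 0.
  by have := act_linearl actP (-1) v F0 F0;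
    rewrite scaler0 addr0 scaleN1r addNr.
have := act_linearl actP (-1) (vbasis {: V})`_k Fm F0.
by rewrite a0 !addr0 !scaleN1r.
Qed.

Lemma conformal_L i j w :
  conformal act b (Fmx C (kappa i) (kappa j)) w = conf_L act i j w.
Proof.
rewrite /conformal /Fmx !flip_kappa.
under eq_bigr => k _ do
  (under eq_bigr => l _ do
     rewrite !mxE !(inj_eq (@kappa_inj n)) scalerBl;
   rewrite sumrB (bigD1 j) //= eqxx andbT big1 ?addr0;
   last (by move=> l /negbTE ->; rewrite andbF scale0r);
   rewrite (bigD1 (flip i)) //= eqxx andbT big1 ?addr0;
   last (by move=> l /negbTE ->; rewrite andbF scale0r)).
rewrite sumrB (bigD1 i) //= eqxx scale1r big1 ?addr0; last first.
  by move=> k /negbTE ->; rewrite scale0r.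
rewrite (bigD1 (flip j)) //= eqxx scale1r big1 ?addr0; last first.
  by move=> k /negbTE ->; rewrite scale0r.
rewrite conf_LN opprK -mulr2n -scaler_nat scalerA mulVf ?pnatr_eq0 // scale1r.
rewrite !mxE ![pivot n == _]eq_sym !kappa_pivot subrr scale0r subr0.
rewrite big1 ?addr0 => [|k _]; last first.
  by rewrite !mxE ![pivot n == _]eq_sym !kappa_pivot subrr scale0r.
rewrite big1 ?subr0 // => k _.
by rewrite !mxE ![pivot n == _]eq_sym !kappa_pivot !andbF subrr scale0r.
Qed.

Let pivE := (eqxx, flipK, flip_kappa, kappa_pivot, kappa_flip_pivot,
  flip_pivot_neq, inj_eq (@kappa_inj n), eq_sym (pivot n), andbF, andFb,
  subrr, subr0, sub0r, scale0r).

Lemma conformal_D w :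
  conformal act b (Fmx C (pivot n) (pivot n)) w = - conf_D b w.
Proof.
rewrite /conformal /Fmx.
rewrite big1 => [|k _]; last by rewrite big1 // => l _; rewrite !mxE !pivE.
rewrite big1 => [|k _]; last by rewrite !mxE !pivE.
rewrite big1 => [|k _]; last by rewrite !mxE !pivE.
by rewrite !mxE !pivE ?scaler0 ?scale1r ?addr0 ?subr0 ?add0r ?sub0r.
Qed.

Lemma conformal_d i w :
  conformal act b (Fmx C (pivot n) (kappa i)) w = conf_d i w.
Proof.
rewrite /conformal /Fmx.
rewrite big1 => [|k _]; last by rewrite big1 // => l _; rewrite !mxE !pivE.
rewrite (bigD1 i) //= big1 => [|k /negbTE ne]; last first.
  by rewrite !mxE !pivE ne !pivE.
rewrite big1 => [|k _]; last by rewrite !mxE !pivE.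
by rewrite !mxE !pivE ?scaler0 ?scale1r ?addr0 ?subr0 ?add0r ?sub0r.
Qed.

Lemma conformal_J i w :
  conformal act b (Fmx C (kappa i) (pivot n)) w = - conf_J act b i w.
Proof.
rewrite /conformal /Fmx.
rewrite big1 => [|k _]; last by rewrite big1 // => l _; rewrite !mxE !pivE.
rewrite big1 => [|k _]; last by rewrite !mxE !pivE.
rewrite (bigD1 i) //= big1 => [|k /negbTE ne]; last first.
  by rewrite !mxE !pivE ne !pivE.
by rewrite !mxE !pivE ?scaler0 ?scale1r ?addr0 ?subr0 ?add0r ?sub0r.
Qed.

End ConformalFacts.

(* Main.v *)
(** A nonzero submodule U of the module contains 1 (x) V, because the d_i
    lower degrees and V is simple.  Let Q = \sum E_(s, r) (x) hatF_(r, s) act on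
    C^(2n+2) (x) (A (x) V).  As Q commutes with the d_i, a polynomial in Q is
    zero as soon as all constant terms of its values are, and this gives

      (Q - b + 2n) \prod_(e in E) (Q - e + 1) (Q + b) = 0

    whenever \prod_(e in E) (T - e) = 0, where T is the analogue of Q on
    C^(2n) (x) V.  If w has degree k and all d_i w lie in U, then
    Q (e_(n+1) (x) w) = - (b + k) e_(n+1) (x) w modulo U, so w lies in U unless
    - (b + k) is b - 2n or some e - 1.  In degree 1, T and b alone show that
    w lies in U unless - b is some e.  The possible e come from the triangular
    action of T on the vectors e_p (x) v, with v a highest weight vector; those p
    for which e_p (x) v lies in the submodule generated by the preceding
    vectors can be left out, and the numbers b which remain excluded are in the
    two families of the theorem. *)

From HB Require Import structures.
Require Import Defs.
From mathcomp Require Import all_boot all_order all_algebra.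
From mathcomp Require Import ring zify.
From Stdlib Require Import Classical_Prop.

Set Implicit Arguments.
Unset Strict Implicit.
Unset Printing Implicit Defensive.

Import Order.TTheory GRing.Theory Num.Theory.
Local Open Scope ring_scope.

(** * The Lie algebra o(2m, C) *)

(** The shape of the identity for Q comes from C^(2n+2) = C e_p + C^(2n) + C e_(p'), with p = n + 1
    and p' its partner. On the constant terms of these three blocks, each taken modulo the preceding
    ones, Q acts as - b, T - 1 and b - 2n.

    Degree 1 has its own argument because for k = 1 the root b - 2n would exclude b = n - 1/2, which
    the theorem allows. From degree 2 on, this root excludes b = n - k/2, and these are exactly the
    numbers in n - 1 - 1/2 N.

    That Q commutes with the d_i presupposes the bracket relations of the conformal action. Only the
    brackets with the d_i are verified on the formulas. The others follow because an element with
    zero constant term and zero derivatives is zero. *)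

Section DeltaSums.

Context (C : pzRingType) (W : lmodType C) (I : finType).

Lemma sum_delta (i : I) (F : I -> W) : \sum_k (k == i)%:R *: F k = F i.
Proof.
rewrite (bigD1 i) //= eqxx scale1r big1 ?addr0 // => k /negbTE ->.
by rewrite scale0r.
Qed.

Lemma sum_deltaM (i : I) (F : I -> C) : \sum_k (k == i)%:R * F k = F i.
Proof.
rewrite (bigD1 i) //= eqxx mul1r big1 ?addr0 // => k /negbTE ->.
by rewrite mul0r.
Qed.

Lemma sum_deltar (i : I) (F : I -> W) : \sum_k (i == k)%:R *: F k = F i.
Proof. by under eq_bigr do rewrite eq_sym; rewrite sum_delta. Qed.

End DeltaSums.

Section So2.

Context (C : numFieldType) (m : nat).

Implicit Types (A B : 'M[C]_(m + m)) (r s t x y : 'I_(m + m)).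

Lemma flip_inj : injective (@flip m). Proof. exact: inv_inj (@flipK m). Qed.

Lemma flip_eq x y : (flip x == y) = (x == flip y).
Proof. by rewrite -(inj_eq flip_inj) flipK. Qed.

Lemma eq_flip x y : (x == flip y) = (y == flip x).
Proof. by rewrite eq_sym flip_eq. Qed.

Lemma flip_eqF r : (flip r == r) = false.
Proof.
apply/negbTE/eqP; case: (split_ordP r) => a ->;
  rewrite ?(flip_lshift, flip_rshift) => /(congr1 val) /= e;
  have := ltn_ord a; lia.
Qed.

Lemma eq_flipF r : (r == flip r) = false.
Proof. by rewrite eq_sym flip_eqF. Qed.

Lemma Fmx_flip r : Fmx C r (flip r) = 0.
Proof. by rewrite /Fmx flipK subrr. Qed.

Lemma FmxE r s x y :
  Fmx C r s x y = (x == r)%:R * (y == s)%:R - (x == flip s)%:R * (y == flip r)%:R.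
Proof. by rewrite /Fmx !mxE -!natrM !mulnb. Qed.

Lemma so2_antisym A : A \in so2 C m ->
  forall x y, A x y = - A (flip y) (flip x).
Proof.
pose X := in_tuple [seq Fmx C i j | i <- enum 'I_(m + m), j <- enum 'I_(m + m)].
move=> AS x y; rewrite (coord_span (X := X) AS) !summxE -sumrN.
apply: eq_bigr => k _; rewrite !mxE -mulrN; congr (_ * _).
have /allpairsP[[r s] [_ _ ->]] : X`_k \in X by rewrite mem_nth // size_tuple.
by rewrite !FmxE /= !flip_eq !flipK opprB [X in _ - X]mulrC [X in X - _]mulrC.
Qed.

(** The terms at (r, s) and (s', r') are equal, since both A and F change sign; hence the factor
    1/2. The formula reduces linear statements on o(2m) to the spanning matrices. *)
Lemma so2_sum A : (forall x y, A x y = - A (flip y) (flip x)) ->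
  A = 2^-1 *: \sum_r \sum_s A r s *: Fmx C r s.
Proof.
move=> AN; apply/matrixP=> x y; rewrite !mxE summxE.
have -> : \sum_r (\sum_s A r s *: Fmx C r s) x y = A x y - A (flip y) (flip x).
    rewrite (eq_bigr (fun r => (r == x)%:R * \sum_s (s == y)%:R * A r s
      - (r == flip y)%:R * \sum_s (s == flip x)%:R * A r s)) => [|r _].
      by rewrite sumrB !sum_deltaM.
  rewrite !mulr_sumr -sumrB summxE; apply: eq_bigr => s _; rewrite mxE FmxE.
  by rewrite (eq_flip x) (eq_flip y) (eq_sym x) (eq_sym y); ring.
by rewrite (AN (flip y)) !flipK; field.
Qed.

Lemma so2P A : A \in so2 C m <-> (forall x y, A x y = - A (flip y) (flip x)).
Proof.
split=> [|/so2_sum ->]; first exact: so2_antisym.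
by apply/memvZ/memv_suml => r _; apply/memv_suml => s _; apply/memvZ/Fmx_so2.
Qed.

Lemma lie_so2 A B : A \in so2 C m -> B \in so2 C m -> lie A B \in so2 C m.
Proof.
move=> /so2P AN /so2P BN; apply/so2P=> x y; rewrite !mxE opprB.
have fl (f : 'I_(m + m) -> C) : \sum_z f z = \sum_z f (flip z).
  exact/reindex_inj/flip_inj.
congr (_ - _); rewrite fl; apply: eq_bigr => z _.
  by rewrite (AN x) (BN _ y) !flipK mulrNN mulrC.
by rewrite (BN x) (AN _ y) !flipK mulrNN mulrC.
Qed.

(** The linear map E_(r, s) |-> F_(r, s) on gl(2m) adds to a matrix its image under the involutive
    automorphism that fixes o(2m), so it commutes with the bracket by A. The formula is the image of
    the one for [A, E_(r, s)]. *)
Lemma lie_Fmx A r s : A \in so2 C m ->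
  lie A (Fmx C r s) = \sum_t A t r *: Fmx C t s - \sum_t A s t *: Fmx C r t.
Proof.
move=> /so2P AN; apply/matrixP=> x y.
rewrite !mxE !summxE.
have E1 : \sum_j A x j * Fmx C r s j y =
   (y == s)%:R * A x r - (y == flip r)%:R * A x (flip s).
  rewrite (eq_bigr (fun j => (j == r)%:R * ((y == s)%:R * A x j) -
     (j == flip s)%:R * ((y == flip r)%:R * A x j))) => [|j _].
    by rewrite sumrB !sum_deltaM.
  by rewrite FmxE ; ring.
have E2 : \sum_j Fmx C r s x j * A j y =
   (x == r)%:R * A s y - (x == flip s)%:R * A (flip r) y.
  rewrite (eq_bigr (fun j => (j == s)%:R * ((x == r)%:R * A j y) -
     (j == flip r)%:R * ((x == flip s)%:R * A j y))) => [|j _].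
    by rewrite sumrB !sum_deltaM.
  by rewrite FmxE ; ring.
have E3 : \sum_t (A t r *: Fmx C t s) x y =
   (y == s)%:R * A x r - (x == flip s)%:R * A (flip y) r.
  rewrite (eq_bigr (fun j => (j == x)%:R * ((y == s)%:R * A j r) -
     (j == flip y)%:R * ((x == flip s)%:R * A j r))) => [|j _].
    by rewrite sumrB !sum_deltaM.
  by rewrite mxE FmxE (eq_flip y j) (eq_sym x j); ring.
have E4 : \sum_t (A s t *: Fmx C r t) x y =
   (x == r)%:R * A s y - (y == flip r)%:R * A s (flip x).
  rewrite (eq_bigr (fun j => (j == y)%:R * ((x == r)%:R * A s j) -
     (j == flip x)%:R * ((y == flip r)%:R * A s j))) => [|j _].
    by rewrite sumrB !sum_deltaM.
  by rewrite mxE FmxE (eq_flip x j) (eq_sym y j); ring.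
rewrite E1 E2 E3 E4 (AN x (flip s)) (AN (flip r) y) !flipK ; ring.
Qed.

Lemma lie_FmxF a c r s : lie (Fmx C a c) (Fmx C r s) =
  (c == r)%:R *: Fmx C a s - (r == flip a)%:R *: Fmx C (flip c) s
  - (s == a)%:R *: Fmx C r c + (s == flip c)%:R *: Fmx C r (flip a).
Proof.
rewrite lie_Fmx ?Fmx_so2 //.
rewrite (eq_bigr (fun t => (t == a)%:R *: ((c == r)%:R *: Fmx C t s)
  - (t == flip c)%:R *: ((r == flip a)%:R *: Fmx C t s))) => [|t _]; last first.
  by rewrite FmxE scalerBl !scalerA (eq_sym r c).
rewrite sumrB !sum_delta.
rewrite (eq_bigr (fun t => (t == c)%:R *: ((s == a)%:R *: Fmx C r t)
  - (t == flip a)%:R *: ((s == flip c)%:R *: Fmx C r t))) => [|t _]; last first.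
  by rewrite FmxE scalerBl !scalerA [_ * (t == c)%:R]mulrC
    [_ * (t == flip a)%:R]mulrC.
by rewrite sumrB !sum_delta opprB addrA [LHS]addrAC.
Qed.

Lemma lieN A B : lie B A = - lie A B. Proof. by rewrite /lie opprB. Qed.

Lemma lie_jacobi D A B : lie D (lie A B) = lie (lie D A) B + lie A (lie D B).
Proof.
rewrite /lie !(mulmxBl, mulmxBr, mulmxA).
rewrite !opprB !addrA; set x1 := D *m A *m B; set x2 := D *m B *m A.
set x3 := A *m B *m D; set x4 := B *m A *m D; set x5 := A *m D *m B.
set x6 := B *m D *m A; clearbody x1 x2 x3 x4 x5 x6.
by apply/eqP; rewrite -subr_eq0; apply/eqP/matrixP=> i j; rewrite !mxE; ring.
Qed.

Lemma lieP D a A B : lie D (a *: A + B) = a *: lie D A + lie D B.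
Proof.
rewrite /lie mulmxDr mulmxDl -scalemxAr -scalemxAl scalerBr opprD.
by rewrite addrACA.
Qed.

Lemma liePl D a A B : lie (a *: A + B) D = a *: lie A D + lie B D.
Proof. by rewrite lieN lieP !(lieN _ D) !scalerN opprD !opprK. Qed.

End So2.

(** * The operator \sum E_(s, r) (x) F_(r, s) *)

Section OpProd.

Context (C : comPzRingType) (W : lmodType C).

(** The product of the operators T - c over the c in s, the last one of which
    is applied first. *)
Definition op_prod (T : W -> W) (s : seq C) (y : W) : W :=
  foldr (fun c z => T z - c *: z) y s.

Lemma op_prod_cat T s1 s2 y :
  op_prod T (s1 ++ s2) y = op_prod T s1 (op_prod T s2 y).
Proof. exact: foldr_cat. Qed.

Lemma op_prod_comm (T f : W -> W) s y :
  (forall a u v, f (a *: u + v) = a *: f u + f v) ->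
  (forall z, f (T z) = T (f z)) -> f (op_prod T s y) = op_prod T s (f y).
Proof.
move=> lf fT; elim: s => //= c s IH.
by rewrite addrC -scaleNr lf fT IH addrC scaleNr.
Qed.

Lemma op_prod_linear (T : W -> W) s : linear T -> linear (op_prod T s).
Proof.
move=> lT a u v; elim: s => //= c s ->.
by rewrite lT !scalerDr scalerN opprD addrACA !scalerA (mulrC c).
Qed.

End OpProd.

(* If T acts as c modulo the T-stable subspace S, then so does its polynomial. *)
Lemma op_prod_mod (C : comPzRingType) (W : lmodType C) (T : W -> W) s
    (S : W -> Prop) (c : C) (y : W) :
  linear T -> S 0 -> (forall a u v, S u -> S v -> S (a *: u + v)) ->
  (forall u, S u -> S (T u)) -> S (T y - c *: y) ->
  S (op_prod T s y - (\prod_(e <- s) (c - e)) *: y).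
Proof.
move=> lT S0 SP ST Sy; elim: s => [|e s IH].
  by rewrite /= big_nil scale1r subrr.
rewrite big_cons /=; set P := \prod_(_ <- _) _ in IH *.
set z := op_prod T s y in IH *.
have Tlin u v a : T (u - a *: v) = T u - a *: T v.
  by rewrite -!scaleNr [u + _]addrC lT addrC.
have SN u v a : S u -> S v -> S (u + a *: v).
  by move=> Su Sv; rewrite addrC; apply: SP.
have -> : T z - e *: z - ((c - e) * P) *: y =
    T (z - P *: y) + (- e) *: (z - P *: y) + P *: (T y - c *: y).
  rewrite Tlin !scalerBr !scaleNr !scalerA mulrBl scalerBl (mulrC c).
  by rewrite opprB opprK !addrA (AC (6) (1*3*4*6*2*5)) /= addrNK.
by apply: (SN) => //; apply: SN => //; apply: ST.
Qed.

(** * Modules over o(2m, C) and the invariance of the operator Q *)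

Section Modules.

Context (C : numFieldType) (m : nat) (W : lmodType C).
Context (act : 'M[C]_(m + m) -> W -> W) (actP : lie_module (so2 C m) act).

Implicit Types (A B : 'M[C]_(m + m)).

Lemma actl0 w : act 0 w = 0.
Proof.
have := act_linearl actP (-1) w (mem0v _) (mem0v _).
by rewrite scaler0 addr0 scaleN1r addNr.
Qed.

Lemma actlZ a A w : A \in so2 C m -> act (a *: A) w = a *: act A w.
Proof.
by move=> AS; have := act_linearl actP a w AS (mem0v _); rewrite actl0 !addr0.
Qed.

Lemma actlD A B w : A \in so2 C m -> B \in so2 C m ->
  act (A + B) w = act A w + act B w.
Proof.
by move=> AS BS; have := act_linearl actP 1 w AS BS; rewrite !scale1r.
Qed.

Lemma actlN A w : A \in so2 C m -> act (- A) w = - act A w.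
Proof. by move=> AS; rewrite -[- A]scaleN1r actlZ // scaleN1r. Qed.

Lemma actl_sum I (r : seq I) (P : pred I) (F : I -> 'M[C]_(m + m)) w :
  (forall i, P i -> F i \in so2 C m) ->
  act (\sum_(i <- r | P i) F i) w = \sum_(i <- r | P i) act (F i) w.
Proof.
move=> FS; elim: r => [|i r IH]; first by rewrite !big_nil actl0.
rewrite !big_cons; case: ifP => // Pi.
by rewrite actlD ?IH ?FS //; apply: memv_suml.
Qed.

Lemma actr0 A : A \in so2 C m -> act A 0 = 0.
Proof.
move=> AS; have := act_linear actP AS (-1) 0 0.
by rewrite scaler0 addr0 scaleN1r addNr.
Qed.

Lemma actrP A a u v : A \in so2 C m -> act A (a *: u + v) = a *: act A u + act A v.
Proof. by move=> AS; apply: (act_linear actP AS). Qed.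

Lemma actrD A u v : A \in so2 C m -> act A (u + v) = act A u + act A v.
Proof. by move=> AS; have := actrP 1 u v AS; rewrite !scale1r. Qed.

Lemma actrZ A a u : A \in so2 C m -> act A (a *: u) = a *: act A u.
Proof. by move=> AS; have := actrP a u 0 AS; rewrite actr0 // !addr0. Qed.

Lemma actrN A u : A \in so2 C m -> act A (- u) = - act A u.
Proof. by move=> AS; rewrite -[- u]scaleN1r actrZ // scaleN1r. Qed.

Lemma actr_sum A I (r : seq I) (P : pred I) (F : I -> W) : A \in so2 C m ->
  act A (\sum_(i <- r | P i) F i) = \sum_(i <- r | P i) act A (F i).
Proof.
move=> AS; elim: r => [|i r IH]; first by rewrite !big_nil actr0.
by rewrite !big_cons; case: ifP => // Pi; rewrite actrD ?IH.
Qed.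

(** The families indexed by 'I_(m + m) form the tensor product of the natural
    module with W; on it [casimir] is \sum_(r, s) E_(s, r) (x) F_(r, s) and
    [diag] is the diagonal action. *)
Definition casimir (y : {ffun 'I_(m + m) -> W}) : {ffun 'I_(m + m) -> W} :=
  [ffun s => \sum_r act (Fmx C r s) (y r)].

Definition diag A (y : {ffun 'I_(m + m) -> W}) : {ffun 'I_(m + m) -> W} :=
  [ffun r => act A (y r) + \sum_t A r t *: y t].

Lemma casimir_linear : linear casimir.
Proof.
move=> a u v; apply/ffunP=> s; rewrite !ffunE scaler_sumr -big_split /=.
by apply: eq_bigr => r _; rewrite !ffunE actrP ?Fmx_so2.
Qed.

Lemma casimir0 : casimir 0 = 0.
Proof.
by have := casimir_linear (-1) 0 0; rewrite scaler0 addr0 scaleN1r addNr.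
Qed.

Lemma diag_linear A : A \in so2 C m -> linear (diag A).
Proof.
move=> AS a u v; apply/ffunP=> s; rewrite !ffunE actrP // scalerDr addrACA.
congr (_ + _); rewrite scaler_sumr -big_split; apply: eq_bigr => r _ /=.
by rewrite !ffunE scalerDr !scalerA mulrC.
Qed.

(** The tensor \sum E_(s, r) (x) F_(r, s) is invariant. Of the two sums in [lie_Fmx], the one with A
    s t is cancelled by the action of A on the natural module outside [casimir], and the one with A
    t r becomes that action inside [casimir]. *)
Lemma casimir_diag A y : A \in so2 C m -> diag A (casimir y) = casimir (diag A y).
Proof.
move=> AS; apply/ffunP=> s; rewrite !ffunE actr_sum //.
under [in RHS]eq_bigr do rewrite ffunE actrD ?Fmx_so2 // actr_sum ?Fmx_so2 //.
rewrite big_split /=.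
have E r : act A (act (Fmx C r s) (y r)) = act (Fmx C r s) (act A (y r)) +
    (\sum_t A t r *: act (Fmx C t s) (y r) - \sum_t A s t *: act (Fmx C r t) (y r)).
  have FS r' s' : Fmx C r' s' \in so2 C m by apply: Fmx_so2.
  apply/eqP; rewrite addrC -subr_eq; apply/eqP; rewrite -(act_lie actP) ?FS //.
  have SS a r' s' : \sum_t a t *: Fmx C (r' t) (s' t) \in so2 C m.
    by apply: memv_suml => t _; apply/memvZ/FS.
  rewrite lie_Fmx // actlD ?memvN ?SS ?(SS _ id) ?(SS _ _ id) //.
  rewrite actlN ?(SS _ _ id) // !actl_sum => [|t _|t _]; try exact/memvZ/FS.
  by congr (_ - _); apply: eq_bigr => t _; rewrite actlZ ?FS.
under eq_bigr do rewrite E; rewrite big_split /= -addrA; congr (_ + _).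
rewrite sumrB exchange_big /= [X in _ - X + _]exchange_big /=.
have -> : \sum_t A s t *: casimir y t =
   \sum_j \sum_i A s j *: act (Fmx C i j) (y i).
  by apply: eq_bigr => t _; rewrite ffunE scaler_sumr.
rewrite subrK; apply: eq_bigr => t _; apply: eq_bigr => r _.
by rewrite actrZ ?Fmx_so2.
Qed.

Lemma sum_Fmx a c r (y : {ffun 'I_(m + m) -> W}) :
  \sum_t Fmx C a c r t *: y t = (r == a)%:R *: y c - (r == flip c)%:R *: y (flip a).
Proof.
rewrite (eq_bigr (fun t => (t == c)%:R *: ((r == a)%:R *: y t) -
  (t == flip a)%:R *: ((r == flip c)%:R *: y t))) => [|t _].
  by rewrite sumrB !sum_delta.
by rewrite FmxE scalerBl !scalerA ![_ * (t == _)%:R]mulrC.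
Qed.

End Modules.

(** * The conformal operators *)

Section Polynomials.

Context (C : numFieldType) (m : nat).

Implicit Types (p : {mpoly C[m]}) (i : 'I_m).

Lemma mcoeff_mul_var0 i p : ('X_i * p)@_0 = 0.
Proof.
by rewrite (mcoeff0_is_multiplicative _ _).1 mcoeffX mnm1_eq0 mul0r.
Qed.

Lemma mderiv_var i k : ('X_i : {mpoly C[m]})^`M(k) = (i == k)%:R.
Proof.
rewrite mderivX mnm1E; case: eqP => [->|_]; last by rewrite scale0r.
rewrite scale1r -[in RHS]mpolyX0; congr mpolyX.
by apply/mnmP=> j; rewrite mnmBE subnn mnm0E.
Qed.

Lemma msize_mderiv p i N : (msize p <= N.+1)%N -> (msize p^`M(i) <= N)%N.
Proof.
move=> sp; rewrite msizeE; apply/bigmax_leqP_seq => u; rewrite mcoeff_msupp.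
rewrite mcoeff_mderiv => nz _; rewrite -ltnS (leq_trans _ sp) //.
have : (u + U_(i))%MM \in msupp p.
  by rewrite mcoeff_msupp; apply: contra_neq nz => ->; rewrite mul0rn.
by move/msize_mdeg_lt; rewrite mdegD mdeg1 addn1.
Qed.

(** In characteristic 0 the coefficient of a monomial divisible by x_i reappears in the i-th
    derivative with a nonzero integer factor. *)
Lemma mderiv_eq0 p : (forall i, p^`M(i) = 0) -> p = (p@_0)%:MP.
Proof.
move=> p0; apply/mpolyP => u; rewrite mcoeffC.
have [->|nz] := eqVneq u 0%MM; first by rewrite mulr1.
rewrite mulr0; case: (pickP (fun i => u i != 0%N)) => [i ui|u0]; last first.
  case/eqP: nz; apply/mnmP => i; rewrite mnmE.
  by have /negbFE/eqP := u0 i.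
have := congr1 (mcoeff (u - U_(i))%MM) (p0 i); rewrite mcoeff_mderiv mcoeff0.
rewrite submK; last by rewrite lep1mP.
by move/eqP; rewrite mulrn_eq0 /= => /eqP.
Qed.

End Polynomials.

(** * Constant terms and derivatives in the tensor product *)

Section Tensor.

Context (C : numFieldType) (m : nat) (V : vectType C).

Local Notation X := (tensor m V).
Local Notation vb := (vbasis {: V}).

Implicit Types (g : {mpoly C[m]}) (v : V) (w : X).

Lemma pure0 v : pure 0 v = 0 :> X.
Proof. by apply/ffunP=> k; rewrite !ffunE scaler0. Qed.

Lemma pure0r g : pure g 0 = 0 :> X.
Proof. by apply/ffunP=> k; rewrite !ffunE linear0 scale0r. Qed.

Lemma pureD g h v : pure (g + h) v = pure g v + pure h v :> X.
Proof. by apply/ffunP=> k; rewrite !ffunE scalerDr. Qed.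

Lemma pureN g v : pure (- g) v = - pure g v :> X.
Proof. by apply/ffunP=> k; rewrite !ffunE scalerN. Qed.

Lemma pureZ a g v : pure (a *: g) v = a *: pure g v :> X.
Proof. by apply/ffunP=> k; rewrite !ffunE !scalerA mulrC. Qed.

Lemma pureDr g u v : pure g (u + v) = pure g u + pure g v :> X.
Proof. by apply/ffunP=> k; rewrite !ffunE linearD scalerDl. Qed.

Lemma pureZr a g v : pure g (a *: v) = a *: pure g v :> X.
Proof. by apply/ffunP=> k; rewrite !ffunE linearZ scalerA. Qed.

Lemma pure_sumr I (r : seq I) P g (F : I -> V) :
  pure g (\sum_(i <- r | P i) F i) = \sum_(i <- r | P i) pure g (F i) :> X.
Proof.
elim: r => [|i r IH]; first by rewrite !big_nil pure0r.
by rewrite !big_cons; case: ifP => // _; rewrite pureDr IH.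
Qed.

Lemma tens_op_linear (T : {mpoly C[m]} -> {mpoly C[m]}) (S : V -> V) :
  linear T -> linear (tens_op T S : X -> X).
Proof.
move=> lT a u v; rewrite /tens_op scaler_sumr -big_split /=.
by apply: eq_bigr => k _; rewrite !ffunE lT pureD pureZ.
Qed.

Lemma linear_sum_gen (U W : lmodType C) (f : U -> W) I (r : seq I) P (F : I -> U) :
  linear f ->
  f (\sum_(i <- r | P i) F i) = \sum_(i <- r | P i) f (F i).
Proof.
move=> lf; have f0 : f 0 = 0.
  by have := lf (-1) 0 0; rewrite scaler0 addr0 scaleN1r addNr.
elim: r => [|i r IH]; first by rewrite !big_nil.
rewrite !big_cons; case: ifP => // _.
by have := lf 1 (F i) (\sum_(j <- r | P j) F j); rewrite !scale1r IH.
Qed.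

Lemma tensor_ext (W : lmodType C) (f h : X -> W) : linear f -> linear h ->
  (forall g v, f (pure g v) = h (pure g v)) -> f =1 h.
Proof.
move=> lf lh e w; rewrite (tensor_sum_pure w) !linear_sum_gen //.
exact: eq_bigr.
Qed.

Definition const_term w : V := \sum_k (w k)@_0 *: vb`_k.

Lemma const_term_linear : linear const_term.
Proof.
move=> a u v; rewrite /const_term scaler_sumr -big_split.
by apply: eq_bigr => k _ /=; rewrite !ffunE mcoeffD mcoeffZ scalerDl scalerA.
Qed.

HB.instance Definition _ :=
  GRing.isLinear.Build C X V _ const_term const_term_linear.

Lemma const_term_add u w : const_term (u + w) = const_term u + const_term w.
Proof. exact: linearD. Qed.

Lemma const_term_scale a w : const_term (a *: w) = a *: const_term w.
Proof. exact: linearZ. Qed.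

Lemma const_term_sum I (r : seq I) P (F : I -> X) :
  const_term (\sum_(i <- r | P i) F i) = \sum_(i <- r | P i) const_term (F i).
Proof. exact: linear_sum. Qed.

Lemma const_term_pure g v : const_term (pure g v) = g@_0 *: v.
Proof.
rewrite /const_term {2}(coord_vbasis (memvf v)) scaler_sumr.
by apply: eq_bigr => k _; rewrite ffunE mcoeffZ scalerA mulrC.
Qed.

Lemma tensor_eq0 w : (forall k, w k = 0) -> w = 0.
Proof. by move=> w0; apply/ffunP=> k; rewrite w0 ffunE. Qed.

(** Induction on a common bound for the degrees of the coordinates, which every derivative lowers.
    Stated through derivatives alone, it remains usable where X is abstract. *)
Lemma tensor_mderiv_ind (P : X -> Prop) : P 0 ->
  (forall w, (forall i, P [ffun k => (w k)^`M(i)]) -> P w) -> forall w, P w.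
Proof.
move=> P0 IP w; have [N] : exists N, forall k, (msize (w k) <= N)%N.
  by exists (\sum_k msize (w k))%N => k; rewrite (bigD1 k) ?leq_addr.
elim: N w => [|N IH] w sw.
  suff -> : w = 0 by [].
  apply: tensor_eq0 => k; apply/eqP; rewrite -msize_poly_eq0 -leqn0; exact: sw.
by apply: IP => i; apply: IH => k; rewrite ffunE; apply: msize_mderiv.
Qed.

Lemma tensor_const w : (forall i k, (w k)^`M(i) = 0) -> w = pure 1 (const_term w).
Proof.
move=> dw; apply/ffunP=> k; rewrite ffunE /const_term coord_sum_free.
  by rewrite alg_mpolyC; apply: mderiv_eq0.
exact: basis_free (vbasisP _).
Qed.

End Tensor.

(** * The blocks of o(2n+2, C) and its parabolic subalgebra *)

Section Indices.

Context (C : numFieldType) (n : nat).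

Implicit Types (i j k : 'I_(n + n)) (A B : 'M[C]_(n.+1 + n.+1)).

Local Notation p := (pivot n).

Lemma kappa_pivotE : forall x : 'I_(n.+1 + n.+1),
  [\/ exists i, x = kappa i, x = p | x = flip p].
Proof.
move=> x; case: (split_ordP x) => a ->; case: (unliftP ord_max a) => [c|] ->.
- constructor 1; exists (lshift n c); rewrite kappa_lshift; congr lshift.
  by apply/val_inj; rewrite /= /bump leqNgt ltn_ord.
- by constructor 2.
- constructor 1; exists (rshift n c); rewrite kappa_rshift; congr rshift.
  by apply/val_inj; rewrite /= /bump leqNgt ltn_ord.
- by constructor 3; rewrite flip_lshift.
Qed.

Lemma sum_kappa (W : nmodType) (f : 'I_(n.+1 + n.+1) -> W) :
  \sum_x f x = \sum_i f (kappa i) + f p + f (flip p).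
Proof.
rewrite !big_split_ord /= !big_ord_recr /= flip_lshift.
under [in RHS]eq_bigr do rewrite kappa_lshift.
under [X in _ = _ + X + _ + _]eq_bigr do rewrite kappa_rshift.
by rewrite !addrA; congr (_ + _); rewrite addrAC.
Qed.

Lemma flip_kappa_pivot i : (flip p == kappa i) = false.
Proof. by rewrite eq_sym kappa_flip_pivot. Qed.

Lemma pivot_kappa i : (p == kappa i) = false.
Proof. by rewrite eq_sym kappa_pivot. Qed.

Lemma pivot_flip : (p == flip p) = false.
Proof. by rewrite eq_sym flip_pivot_neq. Qed.

Definition pivotE := (kappa_pivot, kappa_flip_pivot, flip_kappa_pivot,
  pivot_kappa, pivot_flip, flip_pivot_neq, @flip_kappa n, @flipK n.+1,
  inj_eq (@kappa_inj n), eqxx).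

(** Matrices that involve the index p' need no case of their own: hatF_(r, s) = - hatF_(s', r')
    turns them into one of the four kinds, up to sign, or they are zero. *)
Lemma so2_conf_ind (P : 'M[C]_(n.+1 + n.+1) -> Prop) :
  (forall a A B, A \in so2 C n.+1 -> B \in so2 C n.+1 ->
     P A -> P B -> P (a *: A + B)) ->
  (forall i j, P (Fmx C (kappa i) (kappa j))) -> P (Fmx C p p) ->
  (forall i, P (Fmx C p (kappa i))) -> (forall i, P (Fmx C (kappa i) p)) ->
  forall A, A \in so2 C n.+1 -> P A.
Proof.
move=> lP PL PD Pd PJ.
pose Q A := A \in so2 C n.+1 /\ P A.
have P0 : Q 0.
  split; first exact: mem0v.
  by have := lP (-1) _ _ (Fmx_so2 C p p) (Fmx_so2 C p p) PD PD;
    rewrite scaleN1r addNr.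
have QN A : Q A -> Q (- A).
  move=> [AS PA]; split; first by rewrite memvN.
  by have := lP (-1) _ _ AS P0.1 PA P0.2; rewrite scaleN1r addr0.
have QS (I : finType) (a : I -> C) (F : I -> 'M_(n.+1 + n.+1)) :
    (forall x, Q (F x)) -> Q (\sum_x a x *: F x).
  move=> QF; apply: (big_ind Q) => // [A B [? ?] [? ?]|x _].
    by split; [rewrite memvD | rewrite -[A]scale1r; apply: lP].
  have [FS PF] := QF x.
  split; [exact: memvZ | rewrite -[_ *: _]addr0; exact: lP FS P0.1 PF P0.2].
move=> A /so2_antisym/so2_sum ->.
suff [? ?] : Q (\sum_r \sum_s A r s *: Fmx C r s).
  by rewrite -[_ *: _]addr0; apply: lP => //; [exact: P0.1 | exact: P0.2].
under eq_bigr do rewrite -[\sum_s _]scale1r.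
apply: (QS) => r; apply: QS => s.
have QF r' s' : P (Fmx C r' s') -> Q (Fmx C r' s') by split; first exact: Fmx_so2.
case: (kappa_pivotE r) => [[i ->] | -> | ->];
  case: (kappa_pivotE s) => [[j ->] | -> | ->];
  rewrite ?Fmx_flip; do ?[exact: QF | exact: P0].
- by rewrite -[kappa i]flipK FmxN flip_kappa; apply/QN/QF.
- by rewrite -[kappa j]flipK FmxN flip_kappa; apply/QN/QF.
- by rewrite -[X in Fmx _ _ X]flipK Fmx_flip; exact: P0.
by rewrite FmxN; apply/QN/QF.
Qed.

(** The block of A on the indices of o(2n, C). *)
Definition restr A : 'M[C]_(n + n) := \matrix_(i, j) A (kappa i) (kappa j).

Lemma restr_so2 A : A \in so2 C n.+1 -> restr A \in so2 C n.
Proof.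
by move=> /so2P AN; apply/so2P=> i j; rewrite !mxE AN !flip_kappa.
Qed.

Lemma so2_pivot_flip A : A \in so2 C n.+1 -> A p (flip p) = 0.
Proof.
move=> /so2P/(_ p (flip p)) /eqP; rewrite flipK -addr_eq0 -mulr2n mulrn_eq0.
by move/eqP.
Qed.

Section Parabolic.

Context (A B : 'M[C]_(n.+1 + n.+1)).
Hypotheses (AS : A \in so2 C n.+1) (BS : B \in so2 C n.+1).
Hypotheses (Ap : forall i, A p (kappa i) = 0) (Bp : forall i, B p (kappa i) = 0).

(** The condition A p (kappa i) = 0 says that A has no component along the partial derivatives. Such
    A form the parabolic subalgebra of vector fields vanishing at 0; [restr] and the entry at (p, p)
    give its projection onto the Levi factor o(2n) + C, and the two lemmas that follow show that
    this projection respects brackets. *)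
Lemma lie_parabolic i : lie A B p (kappa i) = 0.
Proof.
rewrite !mxE !sum_kappa Ap Bp !so2_pivot_flip // !mul0r !mulr0 !addr0.
by rewrite !big1 ?subrr // => k _; rewrite ?Ap ?Bp mul0r.
Qed.

Lemma lie_pivot : lie A B p p = 0.
Proof.
rewrite !mxE !sum_kappa !so2_pivot_flip // !mul0r !addr0 [X in _ - (_ + X)]mulrC.
by rewrite !big1 ?add0r ?subrr // => k _; rewrite ?Ap ?Bp mul0r.
Qed.

Lemma restr_lie : restr (lie A B) = lie (restr A) (restr B).
Proof.
have Z D i : D \in so2 C n.+1 -> (forall i, D p (kappa i) = 0) ->
    D (kappa i) (flip p) = 0.
  by move=> /so2P DN Dp; rewrite DN flipK flip_kappa Dp oppr0.
apply/matrixP=> i j; rewrite !mxE !sum_kappa Ap Bp !Z // !mulr0 !mul0r !addr0.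
by congr (_ - _); apply: eq_bigr => k _; rewrite !mxE.
Qed.

End Parabolic.

End Indices.

(** * Commutators with the partial derivatives, and constant terms *)

Section ConformalPolynomials.

Context (C : numFieldType) (n : nat).

Implicit Types (g : {mpoly C[n + n]}) (i j k : 'I_(n + n)).

Lemma mderiv_eta k : (eta C n)^`M(k) = 'X_(flip k).
Proof.
rewrite /eta raddf_sum /=.
under eq_bigr do rewrite mderivM !mderiv_var.
case: (split_ordP k) => a ->; rewrite ?flip_lshift ?flip_rshift.
  rewrite (bigD1 a) //= big1 => [|c /negbTE ne].
    by rewrite eq_rlshift eqxx mul1r mulr0 !addr0.
  by rewrite eq_lshift ne eq_rlshift mul0r mulr0 addr0.
rewrite (bigD1 a) //= big1 => [|c /negbTE ne].
  by rewrite eq_lrshift eqxx mulr1 mul0r add0r addr0.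
by rewrite eq_rshift ne eq_lrshift mul0r mulr0 addr0.
Qed.

Lemma mderiv_opD k g : (opD g)^`M(k) = opD g^`M(k) + g^`M(k).
Proof.
rewrite /opD raddf_sum /=.
under eq_bigr do rewrite mderivM mderiv_var mderiv_comm.
rewrite big_split /= addrC; congr (_ + _).
by rewrite sum_deltaM.
Qed.

Lemma mderiv_opL k i j g : (opL i j g)^`M(k) =
  opL i j g^`M(k) + (i == k)%:R * g^`M(j) - (k == flip j)%:R * g^`M(flip i).
Proof.
rewrite /opL mderivB !mderivM !mderiv_var !(mderiv_comm k) (eq_sym _ (flip j)).
by ring.
Qed.

Lemma mderiv_opJ k i g : (opJ i g)^`M(k) =
  opJ i g^`M(k) + (i == k)%:R * opD g + opL i k g.
Proof.
rewrite /opJ /opL mderivB !mderivM mderiv_var mderiv_eta mderiv_opD.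
by rewrite (mderiv_comm k); ring.
Qed.

Lemma opD_monomial (u : 'X_{1..n + n}) :
  opD ('X_[u] : {mpoly C[n + n]}) = (mdeg u)%:R *: 'X_[u].
Proof.
rewrite mdegE natr_sum scaler_suml /opD; apply: eq_bigr => r _.
rewrite mderivX -scalerAr -mpolyXD.
have [->|nz] := eqVneq (u r) 0%N; first by rewrite !scale0r.
by rewrite addmC submK ?lep1mP.
Qed.

Lemma mcoeff0_opD g : (opD g)@_0 = 0.
Proof.
by rewrite /opD raddf_sum /= big1 // => r _; rewrite mcoeff_mul_var0.
Qed.

Lemma mcoeff0_opL i j g : (opL i j g)@_0 = 0.
Proof. by rewrite /opL mcoeffB !mcoeff_mul_var0 subrr. Qed.

Lemma mcoeff0_opJ i g : (opJ i g)@_0 = 0.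
Proof.
rewrite /opJ /eta mcoeffB mcoeff_mul_var0 mulr_suml raddf_sum /= big1 ?subrr //.
by move=> r _; rewrite -mulrA mcoeff_mul_var0.
Qed.

End ConformalPolynomials.

Section ConformalModule.

Context (C : numFieldType) (n : nat) (V : vectType C).
Context (act : 'M[C]_(n + n) -> V -> V) (b : C).

Local Notation X := (tensor (n + n) V).
Local Notation rho := (conformal act b).
Local Notation p := (pivot n).

Implicit Types (g : {mpoly C[n + n]}) (v : V) (w : X) (i j k : 'I_(n + n)).

Lemma conf_d_linear i : linear (conf_d i : X -> X).
Proof. by apply: tens_op_linear => a u v; rewrite linearP. Qed.

HB.instance Definition _ i := GRing.isLinear.Build C X X _ (@conf_d C n V i)
  (conf_d_linear i).

Lemma conf_D_linear : linear (conf_D b : X -> X).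
Proof.
apply: tens_op_linear => a u v.
by rewrite opD_linear !scalerDr !scalerA [b * a]mulrC addrACA.
Qed.

HB.instance Definition _ := GRing.isLinear.Build C X X _ (@conf_D C n V b)
  conf_D_linear.

Lemma conf_L_linear i j : linear (conf_L act i j : X -> X).
Proof.
move=> a u v; rewrite /conf_L !tens_op_linear => //; last exact: opL_linear.
by rewrite scalerDr addrACA.
Qed.

HB.instance Definition _ i j := GRing.isLinear.Build C X X _ (conf_L act i j)
  (conf_L_linear i j).

Lemma conf_J_linear i : linear (conf_J act b i : X -> X).
Proof.
move=> a u v; rewrite /conf_J tens_op_linear => [|c g h].
  rewrite scalerDr addrACA; congr (_ + _).
  rewrite scaler_sumr -big_split; apply: eq_bigr => q _ /=.
  by rewrite tens_op_linear // => c g h; rewrite mulrDr -scalerAr.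
rewrite opJ_linear mulrDr -scalerAr.
by rewrite !scalerDr !scalerA [b * c]mulrC addrACA.
Qed.

HB.instance Definition _ i := GRing.isLinear.Build C X X _ (conf_J act b i)
  (conf_J_linear i).

Lemma conformal_linear A : linear (rho A).
Proof.
move=> a u v; rewrite /conformal.
have E (I : finType) (F : I -> X -> X) (c : I -> C) :
    (forall x, linear (F x)) ->
    \sum_x c x *: F x (a *: u + v) =
    a *: (\sum_x c x *: F x u) + \sum_x c x *: F x v.
  move=> lF; rewrite scaler_sumr -big_split; apply: eq_bigr => x _ /=.
  by rewrite lF scalerDr !scalerA mulrC.
under eq_bigr => i _ do rewrite (E _ _ _ (conf_L_linear i)).
rewrite (E _ _ _ conf_d_linear) (E _ _ _ conf_J_linear) conf_D_linear.
rewrite big_split /= -scaler_sumr.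
rewrite !(scalerDr, scalerN) !scalerA !opprD.
rewrite ![a * _]mulrC.
by rewrite [in LHS](AC (2*2*2*2) ((1*3*5*7)*(2*4*6*8))).
Qed.

HB.instance Definition _ A := GRing.isLinear.Build C X X _ (rho A)
  (conformal_linear A).

Lemma conformal_linearl a A B w : rho (a *: A + B) w = a *: rho A w + rho B w.
Proof.
rewrite /conformal.
have E (I : finType) (F : I -> X) (c d : I -> C) :
    \sum_x (a * c x + d x) *: F x =
    a *: (\sum_x c x *: F x) + \sum_x d x *: F x.
  rewrite scaler_sumr -big_split; apply: eq_bigr => x _ /=.
  by rewrite scalerDl scalerA.
under eq_bigr do (under eq_bigr do rewrite !mxE; rewrite E).
rewrite big_split /= -scaler_sumr.
under [X in _ + X - _]eq_bigr do rewrite !mxE.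
under [X in _ - X]eq_bigr do rewrite !mxE.
rewrite !E !mxE scalerDl.
rewrite !(scalerDr, scalerN) !scalerA !opprD.
rewrite ![a * _]mulrC.
by rewrite [in LHS](AC (2*2*2*2) ((1*3*5*7)*(2*4*6*8))).
Qed.

(* [linearD] would first unfold [conf_L] and [conf_J] into sums. *)
Lemma conf_d_add i u w : conf_d i (u + w) = conf_d i u + conf_d i w :> X.
Proof. exact: linearD. Qed.

Lemma conf_D_add u w : conf_D b (u + w) = conf_D b u + conf_D b w :> X.
Proof. exact: linearD. Qed.

Lemma conf_L_add i j u w :
  conf_L act i j (u + w) = conf_L act i j u + conf_L act i j w.
Proof. exact: linearD. Qed.

Lemma conf_J_add i u w :
  conf_J act b i (u + w) = conf_J act b i u + conf_J act b i w.
Proof. exact: linearD. Qed.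

Lemma conf_dE i w l : (conf_d i w) l = (w l)^`M(i).
Proof.
suff E : conf_d i w = [ffun l => (w l)^`M(i)] by rewrite E ffunE.
move: w; apply: tensor_ext => [|a u v|g v]; first exact: conf_d_linear.
  by apply/ffunP=> q; rewrite !ffunE linearP.
rewrite /conf_d tens_op_pure // => [|a u w]; last by rewrite linearP.
by apply/ffunP=> q; rewrite !ffunE linearZ.
Qed.

Lemma conf_d_comm i j w : conf_d i (conf_d j w) = conf_d j (conf_d i w).
Proof. by apply/ffunP=> l; rewrite !conf_dE mderiv_comm. Qed.

Lemma conf_d_ind (P : X -> Prop) : P 0 ->
  (forall w, (forall i, P (conf_d i w)) -> P w) -> forall w, P w.
Proof.
move=> P0 IP; apply: tensor_mderiv_ind => // w Pw; apply: IP => i.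
suff -> : conf_d i w = [ffun l => (w l)^`M(i)] by [].
by apply/ffunP=> l; rewrite conf_dE ffunE.
Qed.

Lemma conf_d_eq0 w : (forall i, conf_d i w = 0) -> w = pure 1 (const_term w).
Proof.
by move=> dw; apply: tensor_const => i l; rewrite -conf_dE dw ffunE.
Qed.

Lemma conf_d_const_eq0 w :
  (forall i, conf_d i w = 0) -> const_term w = 0 -> w = 0.
Proof. by move=> /conf_d_eq0 -> /eqP; rewrite const_term_pure mcoeff1 eqxx
  scale1r => /eqP ->; rewrite pure0r. Qed.

End ConformalModule.

Lemma tensor_ind (C : numFieldType) m (V : vectType C) (P : tensor m V -> Prop) :
  (forall u w, P u -> P w -> P (u + w)) -> (forall g v, P (pure g v)) ->
  forall w, P w.
Proof.
move=> PD Pp w; rewrite (tensor_sum_pure w).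
by apply: big_ind => //; rewrite -(pure0 _ 0).
Qed.

Section ConformalLie.

Context (C : numFieldType) (n : nat) (V : vectType C).
Context (act : 'M[C]_(n + n) -> V -> V) (b : C).
Context (actP : lie_module (so2 C n) act).

Local Notation X := (tensor (n + n) V).
Local Notation rho := (conformal act b).
Local Notation p := (pivot n).

Implicit Types (g : {mpoly C[n + n]}) (v : V) (w : X) (i j k : 'I_(n + n)).
Implicit Types (A B : 'M[C]_(n.+1 + n.+1)).

Lemma mul_natZ (a : nat) g : a%:R * g = (a%:R : C) *: g.
Proof. by rewrite mulr_natl scaler_nat. Qed.

Lemma conf_d_D k w : conf_d k (conf_D b w) = conf_D b (conf_d k w) + conf_d k w.
Proof.
elim/tensor_ind: w => [u w IHu IHw|g v].
  by rewrite !linearD /= IHu IHw addrACA.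
rewrite !conf_D_pure !conf_d_pure !conf_D_pure -pureD; congr pure.
by rewrite mderivD mderiv_opD linearZ /= addrAC.
Qed.

Lemma conf_d_L k i j w : conf_d k (conf_L act i j w) =
  conf_L act i j (conf_d k w) + (i == k)%:R *: conf_d j w
  - (k == flip j)%:R *: conf_d (flip i) w.
Proof.
elim/tensor_ind: w => [u w IHu IHw|g v].
  rewrite conf_L_add conf_d_add IHu IHw !conf_d_add conf_L_add !scalerDr !opprD.
  by rewrite [in RHS](AC (2*2*2) ((1*3*5)*(2*4*6))).
rewrite conf_L_pure // conf_d_add !conf_d_pure conf_L_pure // mderiv_opL.
move: (opL _ _ _) => z; rewrite !pureD pureN.
rewrite !mul_natZ !pureZ.
by rewrite [in RHS](AC (2*1*1) ((1*3*4)*2)).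
Qed.

Lemma conf_d_J k i w : conf_d k (conf_J act b i w) =
  conf_J act b i (conf_d k w) + (i == k)%:R *: conf_D b w + conf_L act i k w.
Proof.
elim/tensor_ind: w => [u w IHu IHw|g v].
  rewrite conf_J_add conf_d_add IHu IHw conf_d_add conf_J_add conf_L_add.
  rewrite linearD scalerDr.
  by rewrite [in RHS](AC (2*2*2) ((1*3*5)*(2*4*6))).
rewrite conf_J_pure // conf_d_add linear_sum /= !conf_d_pure conf_J_pure //.
rewrite conf_L_pure // conf_D_pure.
under eq_bigr do rewrite conf_d_pure mderivM mderiv_var pureD mul_natZ pureZ.
rewrite big_split /= sum_delta.
rewrite mderivD mderivZ mderivM mderiv_var mderiv_opJ !mul_natZ.
move: (opJ _ _) (opD _) (opL _ _ _) => z1 z2 z3.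
rewrite !scalerDr !pureD !pureZ !scalerDr !scalerA.
rewrite [b * _]mulrC.
by rewrite [in RHS](AC (2*1*2*2) ((1*4*6)*(5*2)*(7*3))).
Qed.

End ConformalLie.

Section ConformalLieModule.

Context (C : numFieldType) (n : nat) (V : vectType C).
Context (act : 'M[C]_(n + n) -> V -> V) (b : C).
Context (actP : lie_module (so2 C n) act).

Local Notation X := (tensor (n + n) V).
Local Notation rho := (conformal act b).
Local Notation p := (pivot n).

Implicit Types (g : {mpoly C[n + n]}) (v : V) (w : X) (i j k : 'I_(n + n)).
Implicit Types (A B : 'M[C]_(n.+1 + n.+1)).

Lemma const_term_D w : const_term (conf_D b w) = b *: const_term w.
Proof.
elim/tensor_ind: w => [u w IHu IHw|g v].
  by rewrite conf_D_add const_term_add IHu IHw const_term_add scalerDr.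
rewrite conf_D_pure !const_term_pure mcoeffD mcoeff0_opD add0r mcoeffZ.
by rewrite scalerA.
Qed.

Lemma const_term_L i j w :
  const_term (conf_L act i j w) = act (Fmx C i j) (const_term w).
Proof.
elim/tensor_ind: w => [u w IHu IHw|g v].
  by rewrite conf_L_add const_term_add IHu IHw const_term_add (actrD actP) ?Fmx_so2.
rewrite conf_L_pure // const_term_add !const_term_pure.
by rewrite mcoeff0_opL scale0r add0r (actrZ actP) ?Fmx_so2.
Qed.

Lemma const_term_J i w : const_term (conf_J act b i w) = 0.
Proof.
elim/tensor_ind: w => [u w IHu IHw|g v].
  by rewrite conf_J_add const_term_add IHu IHw addr0.
rewrite conf_J_pure // const_term_add const_term_sum const_term_pure.
rewrite mcoeffD mcoeff0_opJ mcoeffZ mcoeff_mul_var0 mulr0 add0r scale0r add0r.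
by apply: big1 => q _; rewrite const_term_pure mcoeff_mul_var0 scale0r.
Qed.

(** A vector field vanishing at 0 acts on values at 0 through the Levi factor: the J_i give 0, L_(i,
    j) gives F_(i, j) and D gives b. The minus sign comes from hatF_(p, p) acting as - D. *)
Lemma const_term_conformal A w : A \in so2 C n.+1 ->
  (forall i, A p (kappa i) = 0) ->
  const_term (rho A w) = act (restr A) (const_term w) - (A p p * b) *: const_term w.
Proof.
move=> AS Ap; rewrite /conformal.
rewrite [X in _ + X - _]big1 ?addr0 => [|i _]; last by rewrite Ap scale0r.
rewrite !linearB /= !const_term_scale const_term_D scalerA !const_term_sum.
rewrite [X in _ - X]big1 ?subr0 => [|i _]; last first.
  by rewrite const_term_scale const_term_J scaler0.
congr (_ - _); rewrite (so2_sum (so2_antisym (restr_so2 AS))) (actlZ actP);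
  last first.
  by do 2![apply: memv_suml => ? _]; apply/memvZ/Fmx_so2.
congr (_ *: _); rewrite (actl_sum actP) => [|i _]; last first.
  by apply: memv_suml => ? _; apply/memvZ/Fmx_so2.
apply: eq_bigr => i _; rewrite const_term_sum (actl_sum actP) => [|j _]; last first.
  exact/memvZ/Fmx_so2.
apply: eq_bigr => j _.
by rewrite const_term_scale const_term_L !mxE (actlZ actP) ?Fmx_so2.
Qed.

Lemma conformalZ a A w : rho (a *: A) w = a *: rho A w.
Proof.
have := conformal_linearl act b a A 0 w; rewrite addr0 => ->.
have := conformal_linearl act b (-1) 0 0 w.
by rewrite scaler0 addr0 scaleN1r addNr => ->; rewrite addr0.
Qed.

Lemma conformalD A B w : rho (A + B) w = rho A w + rho B w.
Proof. by have := conformal_linearl act b 1 A B w; rewrite !scale1r. Qed.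

Lemma conformalN A w : rho (- A) w = - rho A w.
Proof. by rewrite -[- A]scaleN1r conformalZ scaleN1r. Qed.

(** These bracket relations are the only ones verified on explicit formulas; [coinduced_lie_module]
    derives the others from them and from the constant terms. *)
Lemma conf_d_conformal k A w : A \in so2 C n.+1 ->
  conf_d k (rho A w) =
  rho A (conf_d k w) + rho (lie (Fmx C p (kappa k)) A) w.
Proof.
move=> AS; elim/so2_conf_ind: A / AS w => [a A B _ _ IHA IHB||||].
- move=> w; rewrite lieP !conformal_linearl.
  rewrite (conf_d_linear k a : forall u x : X, _) IHA IHB scalerDr.
  by rewrite addrACA.
- move=> i j w; rewrite lie_FmxF !pivotE !conformal_L // !scale0r !subr0.
  rewrite conf_d_L // (eq_sym i) conformalD !conformalZ conformal_d // -addrA.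
  rewrite -[kappa i]flipK FmxN conformalN flip_kappa conformal_d // scalerN.
  by rewrite -flip_eq (eq_sym _ j).
- move=> w; rewrite lie_FmxF !pivotE !scale0r subr0 addr0 scale1r.
  rewrite sub0r conformalN !conformal_D conformal_d //.
  by rewrite linearN /= conf_d_D // opprD.
- move=> i w; rewrite lie_FmxF !pivotE !scale0r !subr0 add0r Fmx_flip scaler0.
  by rewrite !conformal_d // conf_d_comm -[0](subrr 0) conformalD conformalN subrr
     addr0.
move=> i w; rewrite lie_FmxF !pivotE !scale0r subr0 addr0 scale1r.
rewrite !conformal_J // conformalD conformalN conformalZ conformal_D //.
rewrite conformal_L // linearN /= conf_d_J // 2!opprD scalerN (eq_sym k).
exact: esym (addrA _ _ _).
Qed.

End ConformalLieModule.

(* Of the tensor product only the derivations and the evaluation ct at 0 matter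
   here; working with an abstract X also keeps [rewrite] from unfolding
   [conformal] and [const_term]. *)
Section Coinduced.

Context (C : numFieldType) (n : nat) (X V : lmodType C).
Context (act : 'M[C]_(n + n) -> V -> V) (b : C).
Context (rho : 'M[C]_(n.+1 + n.+1) -> X -> X) (ct : X -> V).

Local Notation p := (pivot n).
Local Notation dv k := (Fmx C p (kappa k)).

Context (actP : lie_module (so2 C n) act).
Context (rho_linear : forall A, linear (rho A)).
Context (rho_linearl : forall a A B w, rho (a *: A + B) w = a *: rho A w + rho B w).
Context (rho_d : forall k A w, A \in so2 C n.+1 ->
  rho (dv k) (rho A w) = rho A (rho (dv k) w) + rho (lie (dv k) A) w).
Context (rho_ind : forall P : X -> Prop, P 0 ->
  (forall w, (forall k, P (rho (dv k) w)) -> P w) -> forall w, P w).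
Context (ct_linear : linear ct).
Context (ct_rho : forall A w, A \in so2 C n.+1 ->
  (forall i, A p (kappa i) = 0) ->
  ct (rho A w) = act (restr A) (ct w) - (A p p * b) *: ct w).
Context (ct_eq0 : forall w, (forall k, rho (dv k) w = 0) -> ct w = 0 -> w = 0).

Implicit Types (w : X) (i j k : 'I_(n + n)).
Implicit Types (A B : 'M[C]_(n.+1 + n.+1)).

Let rho_sub A u w : rho A (u - w) = rho A u - rho A w.
Proof.
by rewrite [u - w]addrC -scaleN1r rho_linear scaleN1r addrC.
Qed.

Let rho0 A : rho A 0 = 0.
Proof. by have := rho_sub A 0 0; rewrite !subrr. Qed.

Let rho_add A u w : rho A (u + w) = rho A u + rho A w.
Proof. by have := rho_linear A 1 u w; rewrite !scale1r. Qed.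

Let ct_sub u w : ct (u - w) = ct u - ct w.
Proof.
by rewrite [u - w]addrC -scaleN1r ct_linear scaleN1r addrC.
Qed.

Let rho0l w : rho 0 w = 0.
Proof. by have := rho_linearl (-1) 0 0 w; rewrite scaler0 addr0 scaleN1r addNr. Qed.

Let rho_addl A B w : rho (A + B) w = rho A w + rho B w.
Proof. by have := rho_linearl 1 A B w; rewrite !scale1r. Qed.

Let rho_oppl A w : rho (- A) w = - rho A w.
Proof.
by have := rho_linearl (-1) A 0 w; rewrite rho0l !addr0 !scaleN1r.
Qed.

(** * The bracket relations of a coinduced module *)

(** The failure of [rho] to respect the bracket of A and B at w. By [ct_eq0] its vanishing can be
    tested on its derivatives and its constant term. *)
Definition bracket_defect A B w :=
  rho (lie A B) w - (rho A (rho B w) - rho B (rho A w)).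

Local Notation Z := bracket_defect.

Lemma bracket_defect_d k A w : A \in so2 C n.+1 ->
  Z (dv k) A w = 0.
Proof.
move=> AS; rewrite /Z rho_d //.
by rewrite [X in _ - X]addrAC subrr add0r subrr.
Qed.

Lemma bracket_defectN A B w : Z A B w = - Z B A w.
Proof.
rewrite /Z (lieN A B) rho_oppl.
move: (rho (lie A B) w) (rho A _) (rho B _) => x y z.
by rewrite -opprD opprK opprB.
Qed.

(** A Leibniz rule, due to the Jacobi identity and [rho_d]: the derivative of a defect is a sum of
    three defects, in which w, A or B is replaced by its derivative or its bracket with the
    derivation. *)
Lemma rho_bracket_defect k A B w : A \in so2 C n.+1 -> B \in so2 C n.+1 ->
    rho (dv k) (Z A B w) = Z A B (rho (dv k) w) +
      (Z (lie (dv k) A) B w + Z A (lie (dv k) B) w).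
Proof.
move=> AS BS; rewrite /Z.
have E D F : D \in so2 C n.+1 -> F \in so2 C n.+1 ->
    rho (dv k) (rho D (rho F w)) = rho D (rho F (rho (dv k) w)) +
      rho D (rho (lie (dv k) F) w) + rho (lie (dv k) D) (rho F w).
  by move=> DS FS; rewrite rho_d // rho_d // rho_add.
rewrite !rho_sub (E A B) // (E B A) // rho_d ?lie_so2 // lie_jacobi rho_addl.
move: (rho (lie A B) _) (rho (lie _ B) w) (rho (lie A _) w).
move: (rho A (rho B _)) (rho A (rho _ w)) (rho (lie (dv k) A) (rho B w)).
move: (rho B (rho A _)) (rho B (rho _ w)) (rho (lie (dv k) B) (rho A w)).
move=> x1 x2 x3 x4 x5 x6 x7 x8 x9.
rewrite !opprD !opprK; set y4 := - x4; set y5 := - x5; set y6 := - x6.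
by rewrite (AC ((1*2)*(3*3)) ((1*(4*7))*((2*(6*8))*(3*(5*9))))).
Qed.

(* For d > 0 and A seen as a vector field: A vanishes to order d - 1 at 0. *)
Fixpoint filtered d A : Prop :=
  A \in so2 C n.+1 /\
  match d with
  | 0 => forall B w, B \in so2 C n.+1 -> Z A B w = 0
  | d.+1 => (forall i, A p (kappa i) = 0) /\
            forall k, filtered d (lie (dv k) A)
  end.

Lemma filtered_so2 d A : filtered d A -> A \in so2 C n.+1.
Proof. by case: d => [|d] []. Qed.

Lemma ct_bracket_defect A B w : A \in so2 C n.+1 -> B \in so2 C n.+1 ->
  (forall i, A p (kappa i) = 0) -> (forall i, B p (kappa i) = 0) ->
  ct (Z A B w) = 0.
Proof.
move=> AS BS Ap Bp; rewrite /Z !ct_sub.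
rewrite !ct_rho ?lie_so2 //; last exact: lie_parabolic.
rewrite restr_lie // lie_pivot // mul0r scale0r subr0.
have [RA RB] := (restr_so2 AS, restr_so2 BS).
rewrite (act_lie actP) // -!scaleNr !(actrD actP) // !(actrZ actP) //.
rewrite !scalerDr !scalerA !opprD.
rewrite !mulrNN [B p p * b * _]mulrC !scaleNr !opprK.
move: (act _ (act _ _)) (act _ (act _ _)) (_ *: act _ _) (_ *: act _ _)
  => x1 x2 y1 y2.
move: (_ *: ct w) => z.
by rewrite (AC (2*(2*2*(2*2))) ((1*3)*(2*7)*(4*9)*(5*8)*(6*10))) /=
  !(subrr, addNr) !addr0.
Qed.

(** Nested induction on w, d and e. When d and e are positive, the three terms of the Leibniz rule
    are covered by the three induction hypotheses, and the constant term vanishes because A and B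
    lie in the parabolic subalgebra. At level 0 the defect vanishes by definition. *)
Lemma bracket_defect_filtered w d e A B : filtered d A -> filtered e B ->
  Z A B w = 0.
Proof.
elim/rho_ind: w d e A B => [|w IHw] d e A B.
  by move=> _ _; rewrite /Z !rho0 !subr0.
elim: d e A B => [|d IHd] e A B; first by move=> [_ ZA] /filtered_so2 BS; apply: ZA.
elim: e B => [|e IHe] B FA FB.
  by case: FB => _ ZB; rewrite bracket_defectN ZB ?oppr0 // (filtered_so2 FA).
have [AS BS] := (filtered_so2 FA, filtered_so2 FB).
case: (FA) (FB) => _ [Ap dA] [_ [Bp dB]].
apply: ct_eq0 => [k|]; last exact: ct_bracket_defect.
rewrite rho_bracket_defect // (IHw _ d.+1 e.+1) //.
by rewrite (IHd e.+1 _ _ (dA k) FB) (IHe _ FA (dB k)) !addr0.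
Qed.

Lemma filtered_d k : filtered 0 (dv k).
Proof. by split; [exact: Fmx_so2 | move=> B w BS; apply: bracket_defect_d]. Qed.

Lemma filteredP d a A B : filtered d A -> filtered d B -> filtered d (a *: A + B).
Proof.
elim: d A B => [|d IH] A B [AS FA] [BS FB]; (split; first by rewrite memvD ?memvZ).
  move=> D w DS; rewrite /Z liePl !rho_linearl.
  have := FA D w DS; have := FB D w DS; rewrite /Z rho_linear.
  move=> /eqP; rewrite subr_eq0 => /eqP ->; move=> /eqP; rewrite subr_eq0 => /eqP ->.
  by rewrite scalerBr addrACA -opprD subrr.
split=> [i|k]; first by rewrite !mxE FA.1 FB.1 mulr0 addr0.
by rewrite lieP; apply: IH; [apply: FA.2 | apply: FB.2].
Qed.

Lemma coinduced_lie_module : lie_module (so2 C n.+1) rho.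
Proof.
split=> [A _|a A B w _ _|A B w AS BS]; first exact: rho_linear.
  exact: rho_linearl.
have F0 d : filtered d 0.
  have Z0 : (0 : 'M[C]_(n.+1 + n.+1)) \in so2 C n.+1 by exact: mem0v.
  elim: d => [|d IH]; split=> //.
    by move=> D w' DS; rewrite /Z /lie mul0mx mulmx0 subrr !rho0l rho0 !subr0.
  split=> [i|k]; first by rewrite mxE.
  by rewrite /lie mul0mx mulmx0 subrr.
have FZ d a D : filtered d D -> filtered d (a *: D).
  by move=> FD; rewrite -[_ *: _]addr0; apply: filteredP.
(* The levels follow the degrees of the vector fields: bracketing with the derivations takes D and
   L_(i, j) to derivations, and J_i to combinations of D and the L_(i, j). *)
have FD : filtered 1 (Fmx C p p).
  split; first exact: Fmx_so2.
  split=> [i|k]; first by rewrite FmxE !pivotE mulr0 mul0r subr0.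
  rewrite lie_FmxF !pivotE !scale0r subr0 addr0 sub0r -scaleN1r scale1r.
  exact/FZ/filtered_d.
have FL i j : filtered 1 (Fmx C (kappa i) (kappa j)).
  split; first exact: Fmx_so2.
  split=> [l|k]; first by rewrite FmxE !pivotE !mul0r subr0.
  rewrite lie_FmxF !pivotE !scale0r !subr0 -[kappa i]flipK FmxN flip_kappa.
  by apply: filteredP; [|rewrite scalerN -scaleNr; apply: FZ];
    apply: filtered_d.
have FJ i : filtered 2 (Fmx C (kappa i) p).
  split; first exact: Fmx_so2.
  split=> [l|k]; first by rewrite FmxE !pivotE !mul0r subr0.
  rewrite lie_FmxF !pivotE !scale0r subr0 addr0 scale1r.
  by apply: filteredP => //; rewrite -scaleN1r; apply: FZ.
suff G : forall D E x, D \in so2 C n.+1 -> E \in so2 C n.+1 -> Z D E x = 0.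
  by apply/eqP; rewrite -subr_eq0; apply/eqP/G.
move=> D E x DS ES {A B w AS BS}.
have ZP F a D1 D2 : Z D1 F x = 0 -> Z D2 F x = 0 -> Z (a *: D1 + D2) F x = 0.
  rewrite /Z liePl !rho_linearl.
  rewrite rho_linear => /eqP; rewrite subr_eq0 => /eqP ->.
  move=> /eqP; rewrite subr_eq0 => /eqP ->.
  by rewrite scalerBr addrACA -opprD subrr.
have ZF d D0 F : filtered d D0 -> F \in so2 C n.+1 -> Z D0 F x = 0.
  move=> FD0 FS; rewrite bracket_defectN; apply/eqP; rewrite oppr_eq0; apply/eqP.
  elim/so2_conf_ind: F / FS => [a F1 F2 _ _||||]; first exact: ZP.
  - by move=> i j; apply: bracket_defect_filtered (FL i j) FD0.
  - exact: bracket_defect_filtered FD FD0.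
  - by move=> i; apply: bracket_defect_filtered (filtered_d i) FD0.
  - by move=> i; apply: bracket_defect_filtered (FJ i) FD0.
elim/so2_conf_ind: D / DS => [a D1 D2 _ _||||]; first exact: ZP.
- by move=> i j; apply: ZF (FL i j) ES.
- exact: ZF FD ES.
- by move=> i; apply: ZF (filtered_d i) ES.
- by move=> i; apply: ZF (FJ i) ES.
Qed.

(** * The polynomial identity for Q *)

Let rhoP : lie_module (so2 C n.+1) rho := coinduced_lie_module.

Local Notation Y := {ffun 'I_(n.+1 + n.+1) -> X}.
Local Notation Q := (casimir rho).
Local Notation dg k := (diag rho (dv k)).
Local Notation dgs l y := (foldr (fun k => dg k) y l).

Implicit Types (y z : Y) (l : seq 'I_(n + n)).

Let ct0 : ct 0 = 0.
Proof. by have := ct_sub 0 0; rewrite !subrr. Qed.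

Let ct_add u w : ct (u + w) = ct u + ct w.
Proof. by have := ct_linear 1 u w; rewrite !scale1r. Qed.

Let ct_opp w : ct (- w) = - ct w.
Proof. by rewrite -[- w]add0r ct_sub ct0 add0r. Qed.

Let ct_scale a w : ct (a *: w) = a *: ct w.
Proof. by have := ct_linear a w 0; rewrite ct0 !addr0. Qed.

Let ct_sum I (r : seq I) (F : I -> X) :
  ct (\sum_(i <- r) F i) = \sum_(i <- r) ct (F i).
Proof. by elim: r => [|i r IH]; rewrite ?big_nil // !big_cons ct_add IH. Qed.

Let ct_J i w : ct (rho (Fmx C (kappa i) p) w) = 0.
Proof.
rewrite ct_rho ?Fmx_so2 // => [|k]; last by rewrite FmxE !pivotE !mul0r subr0.
have -> : restr (Fmx C (kappa i) p) = 0.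
  by apply/matrixP=> k j; rewrite !mxE !pivotE !andbF subrr.
by rewrite (actl0 actP) FmxE !pivotE !(mul0r, subr0, scale0r).
Qed.

Let ct_D w : ct (rho (Fmx C p p) w) = - (b *: ct w).
Proof.
rewrite ct_rho ?Fmx_so2 // => [|k]; last by rewrite FmxE !pivotE mulr0 mul0r subr0.
have -> : restr (Fmx C p p) = 0.
  by apply/matrixP=> k j; rewrite !mxE !pivotE subrr.
by rewrite (actl0 actP) FmxE !pivotE !(mul0r, subr0, mul1r) sub0r.
Qed.

Let ct_L i j w : ct (rho (Fmx C (kappa i) (kappa j)) w) = act (Fmx C i j) (ct w).
Proof.
rewrite ct_rho ?Fmx_so2 // => [|k]; last by rewrite FmxE !pivotE !mul0r subr0.
have -> : restr (Fmx C (kappa i) (kappa j)) = Fmx C i j.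
  by apply/matrixP=> k l; rewrite !mxE !pivotE.
by rewrite FmxE !pivotE !(mul0r, subr0, scale0r).
Qed.

Let ct_casimir_p y : ct (Q y p) = - (b *: ct (y p)).
Proof.
rewrite ffunE sum_kappa !ct_add ct_sum big1 => [|i _]; last exact: ct_J.
by rewrite ct_D -[X in Fmx C (flip p) X]flipK Fmx_flip rho0l ct0 add0r addr0.
Qed.

Definition level0 y : {ffun 'I_(n + n) -> V} := [ffun i => ct (y (kappa i))].

Let ct_casimir_kappa y j : ct (Q y (kappa j)) =
  casimir act (level0 y) j + ct (rho (dv j) (y p)).
Proof.
rewrite !ffunE sum_kappa !ct_add ct_sum -[X in Fmx C (flip p) X]flipK FmxN.
rewrite rho_oppl ct_opp flip_kappa ct_J oppr0 addr0; congr (_ + _).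
by apply: eq_bigr => i _; rewrite ffunE ct_L.
Qed.

Let ct_casimir_flip y : ct (Q y (flip p)) =
  b *: ct (y (flip p)) - \sum_i ct (rho (dv (flip i)) (y (kappa i))).
Proof.
rewrite !ffunE sum_kappa !ct_add ct_sum Fmx_flip rho0l ct0 addr0.
rewrite FmxN rho_oppl ct_opp ct_D opprK addrC -sumrN; congr (_ + _).
apply: eq_bigr => i _.
by rewrite -[X in Fmx C X (flip p)]flipK FmxN rho_oppl ct_opp flip_kappa.
Qed.

(* ffunE would also unfold the families themselves *)
Let ct_sub_scale y z c r : ct ((y - c *: z) r) = ct (y r) - c *: ct (z r).
Proof. by rewrite ffunE [(- (c *: z)) r]ffunE [(c *: z) r]ffunE ct_sub ct_scale. Qed.

Let dgE k y r : dg k y r = rho (dv k) (y r) + (r == p)%:R *: y (kappa k)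
  - (r == flip (kappa k))%:R *: y (flip p).
Proof. by rewrite ffunE sum_Fmx addrA. Qed.

Let dgs_linear l a u z : dgs l (a *: u + z : Y) = a *: dgs l u + dgs l z.
Proof.
elim: l => //= k l ->.
by rewrite (diag_linear rhoP) ?Fmx_so2.
Qed.

Let dgs_casimir l y : dgs l (Q y) = Q (dgs l y).
Proof. by elim: l => //= k l ->; rewrite (casimir_diag rhoP) ?Fmx_so2. Qed.

Let dgs_op_prod l s y : dgs l (op_prod Q s y) = op_prod Q s (dgs l y).
Proof.
apply: (op_prod_comm (f := fun y => dgs l y)); first exact: dgs_linear.
exact: dgs_casimir.
Qed.

(** Three stages of vanishing constant terms: at p, then also on the middle block, then everywhere.
    They are required of all images of y under the diagonal derivations, because these mix the
    blocks and vanishing has to be propagated through them. *)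
Let van0 y := forall l, ct (dgs l y p) = 0.
Let van1 y := forall l, ct (dgs l y p) = 0 /\ level0 (dgs l y) = 0.
Let van2 y := forall l r, ct (dgs l y r) = 0.

Let van0_factor y : van0 (op_prod Q [:: - b] y).
Proof.
move=> l; rewrite dgs_op_prod /= ct_sub_scale ct_casimir_p scaleNr opprK.
by rewrite addNr.
Qed.

(** Origin of the shift e - 1: the middle block of Q y contains the extra term ct (d_j y_p). As the
    diagonal derivation of y has zero constant term at p, this term equals minus the constant term
    of y at kappa j. *)
Let level0_casimir y : van0 y -> level0 (Q y) = casimir act (level0 y) - level0 y.
Proof.
move=> y0; apply/ffunP=> j; rewrite [LHS]ffunE ct_casimir_kappa !ffunE.
congr (_ + _); have := y0 [:: j].
by rewrite /= dgE !pivotE scale1r scale0r subr0 ct_add => /eqP;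
  rewrite addr_eq0 => /eqP.
Qed.

Let van0_shift y c : van0 y -> van0 (Q y - c *: y).
Proof.
move=> y0 l; rewrite addrC -scaleNr dgs_linear dgs_casimir addrC scaleNr.
by rewrite ct_sub_scale ct_casimir_p y0 !scaler0 subr0 oppr0.
Qed.

Let level0_linear : linear level0.
Proof.
by move=> a u z; apply/ffunP=> i; rewrite !ffunE ct_add ct_scale.
Qed.

Let level0_op_prod s y : van0 y ->
  van0 (op_prod Q [seq e - 1 | e <- s] y) /\
  level0 (op_prod Q [seq e - 1 | e <- s] y) = op_prod (casimir act) s (level0 y).
Proof.
move=> y0; elim: s => //= e s [IH0 <-]; split; first exact: van0_shift.
rewrite addrC -scaleNr level0_linear level0_casimir // scaleNr.
by rewrite scalerBl scale1r opprB addrC addrA subrK.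
Qed.

Let van1_factor s y : (forall v, op_prod (casimir act) s v = 0) -> van0 y ->
  van1 (op_prod Q [seq e - 1 | e <- s] y).
Proof.
move=> s0 y0 l; rewrite dgs_op_prod.
have z0 : van0 (dgs l y) by move=> l'; rewrite -foldr_cat; apply: y0.
have [w0 ->] := level0_op_prod s z0; rewrite s0; split=> //.
exact: (w0 [::]).
Qed.

(** Origin of the root b - 2n: at p' the operator Q gives b times the constant term, minus the sum
    over i of the constant terms of d_(i') y_(kappa i). When the middle block vanishes, each of
    these 2n terms equals the constant term of y at p'. *)
Let van2_factor y : van1 y -> van2 (op_prod Q [:: b - (n + n)%:R] y).
Proof.
move=> y1 l; rewrite dgs_op_prod /=.
have z1 : van1 (dgs l y) by move=> l'; rewrite -foldr_cat; apply: y1.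
move: (dgs l y) z1 => z {y y1} z1 r.
have z0 : van0 z by move=> l'; have [] := z1 l'.
have [zp zk] := z1 [::]; rewrite /= in zp zk.
rewrite ct_sub_scale.
case: (kappa_pivotE r) => [[j ->] | -> | ->].
- have levelE (x : Y) : ct (x (kappa j)) = level0 x j by rewrite [RHS]ffunE.
  rewrite !levelE level0_casimir // zk (casimir0 actP) subrr ffunE.
  by rewrite scaler0 subrr.
- by rewrite ct_casimir_p zp !scaler0 !oppr0 addr0.
rewrite ct_casimir_flip scalerBl opprB (AC (2*2) ((1*4)*(3*2))) /= subrr add0r.
apply/eqP; rewrite subr_eq0 scaler_nat; apply/eqP.
rewrite (eq_bigr (fun=> ct (z (flip p)))) => [|i _]; last first.
  have [_ /(congr1 (fun f : {ffun _} => f i))] := z1 [:: flip i].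
  rewrite [X in X = _]ffunE [X in _ = X]ffunE /= dgE !pivotE flipK eqxx.
  rewrite scale0r addr0 scale1r ct_sub => /eqP.
  by rewrite subr_eq0 => /eqP.
by rewrite sumr_const card_ord.
Qed.

Let stable_eq0 (S : X -> Prop) : (forall w, S w -> ct w = 0) ->
  (forall w k, S w -> S (rho (dv k) w)) -> forall w, S w -> w = 0.
Proof.
move=> S0 Sd w; elim/rho_ind: w => // w IH Sw.
by apply: ct_eq0 (S0 _ Sw) => k; apply/IH/Sd.
Qed.

(** The components are treated in the order p', middle block, p. Once the blocks treated before are
    zero, the diagonal derivation is the plain one on the next block, and [stable_eq0] applies. *)
Let van2_eq0 y : van2 y -> y = 0.
Proof.
have dgv k z : van2 z -> van2 (dg k z).
  by move=> z2 l r; rewrite -[dg k z]/(dgs [:: k] z) -foldr_cat; apply: z2.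
have H (r : 'I_(n.+1 + n.+1)) :
    (forall k z, van2 z -> rho (dv k) (z r) = dg k z r) ->
    forall z, van2 z -> z r = 0.
  move=> rd z z2; apply: (@stable_eq0 (fun w => exists2 z, van2 z & w = z r)).
  - by move=> _ [z' z2' ->]; apply: (z2' [::]).
  - by move=> _ k [z' z2' ->]; exists (dg k z'); [exact: dgv | exact: rd].
  by exists z.
have Hf : forall z, van2 z -> z (flip p) = 0.
  by apply: H => k z _; rewrite dgE !pivotE !scale0r subr0 addr0.
have Hk i : forall z, van2 z -> z (kappa i) = 0.
  by apply: H => k z z2; rewrite dgE Hf // !pivotE scale0r scaler0 subr0 addr0.
have Hp : forall z, van2 z -> z p = 0.
  by apply: H => k z z2; rewrite dgE Hf // Hk // !scaler0 subr0 addr0.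
move=> y2; apply/ffunP=> r; rewrite ffunE.
by case: (kappa_pivotE r) => [[j ->] | -> | ->]; [apply: Hk | apply: Hp | apply: Hf].
Qed.

(** [op_prod] applies the last factor first, and the list is arranged for that: - b clears p, the
    shifted roots of T clear the middle block, and b - 2n clears p'. Each stage presupposes the
    preceding ones. *)
Lemma casimir_identity s y : (forall v, op_prod (casimir act) s v = 0) ->
  op_prod (casimir rho)
    ((b - (n + n)%:R) :: [seq e - 1 | e <- s] ++ [:: - b]) y = 0.
Proof.
move=> s0; rewrite -cat1s !op_prod_cat.
exact/van2_eq0/van2_factor/van1_factor/van0_factor.
Qed.

End Coinduced.

Section ConformalModule.

Context (C : numFieldType) (n : nat) (V : vectType C).
Context (act : 'M[C]_(n + n) -> V -> V) (b : C).
Context (actP : lie_module (so2 C n) act).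

Local Notation X := (tensor (n + n) V).
Local Notation rho := (conformal act b).
Local Notation dv k := (Fmx C (pivot n) (kappa k)).

Let rho_d k A (w : X) : A \in so2 C n.+1 ->
  rho (dv k) (rho A w) = rho A (rho (dv k) w) + rho (lie (dv k) A) w.
Proof. by move=> AS; rewrite !conformal_d // conf_d_conformal. Qed.

Let rho_ind (P : X -> Prop) : P 0 ->
  (forall w, (forall k, P (rho (dv k) w)) -> P w) -> forall w, P w.
Proof.
move=> P0 IP; apply: conf_d_ind => // w IH; apply: IP => k.
by rewrite conformal_d.
Qed.

Let ct_eq0 (w : X) : (forall k, rho (dv k) w = 0) -> const_term w = 0 -> w = 0.
Proof. by move=> dw; apply: conf_d_const_eq0 => k; rewrite -(dw k) conformal_d. Qed.

Lemma conformal_lie_module : lie_module (so2 C n.+1) rho.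
Proof.
exact: (coinduced_lie_module actP (conformal_linear act b)
  (conformal_linearl act b) rho_d rho_ind (@const_term_linear _ _ V)
  (const_term_conformal b actP) ct_eq0).
Qed.

Lemma conformal_casimir s y : (forall v, op_prod (casimir act) s v = 0) ->
  op_prod (casimir rho)
    ((b - (n + n)%:R) :: [seq e - 1 | e <- s] ++ [:: - b]) y = 0.
Proof.
exact: (casimir_identity actP (conformal_linear act b)
  (conformal_linearl act b) rho_d rho_ind (@const_term_linear _ _ V)
  (const_term_conformal b actP) ct_eq0).
Qed.

End ConformalModule.

(** * Highest weight vectors *)

Section Sl2.

Context (C : numFieldType) (V : vectType C) (h : V -> V).
Context (h_linear : linear h).

Lemma eigenvectors_free (w : nat -> V) (c : nat -> C) : injective c ->
  (forall k, h (w k) = c k *: w k) -> (forall k, w k != 0) ->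
  forall N, free [seq w k | k <- rev (iota 0 N)].
Proof.
move=> c_inj hw nz; elim=> [|N IH]; first exact: nil_free.
have prodE k s : op_prod h s (w k) = \prod_(e <- s) (c k - e) *: w k.
  apply/eqP; rewrite -subr_eq0; apply/eqP.
  apply: (@op_prod_mod _ _ h s (fun y => y = 0)) => //.
  - by move=> a u v -> ->; rewrite scaler0 addr0.
  - move=> u ->; have := h_linear (-1) 0 0.
    by rewrite scaler0 addr0 scaleN1r addNr.
  by rewrite hw subrr.
rewrite -addn1 iotaD rev_cat /= free_cons IH andbT add0n; apply/negP => wN.
set r := rev (iota 0 N) in wN IH *; pose s := [seq c k | k <- r].
have rE k : (k \in r) = (k < N)%N by rewrite mem_rev mem_iota.
suff : op_prod h s (w N) = 0.
  move/eqP; rewrite prodE scaler_eq0 (negbTE (nz N)) orbF prodf_seq_eq0.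
  case/hasP=> e /mapP[k]; rewrite rE => ltkN -> /=.
  by rewrite subr_eq0 => /eqP/c_inj e'; rewrite e' ltnn in ltkN.
rewrite (coord_span (X := in_tuple [seq w k | k <- r]) wN).
rewrite linear_sumZ; last exact: op_prod_linear.
apply: big1 => i _; have : (in_tuple [seq w k | k <- r])`_i \in [seq w k | k <- r].
  by rewrite mem_nth //= ltn_ord.
case/mapP => k kr ->; rewrite prodE; apply/eqP; rewrite scaler_eq0 scaler_eq0.
apply/orP; right; apply/orP; left; rewrite prodf_seq_eq0.
by apply/hasP; exists (c k); [exact: map_f | rewrite /= subrr].
Qed.

(** If [w 0] were nonzero, all [w k] would be, and finitely many of them would already be too many
    independent vectors for V. *)
Lemma eigenvectors_eq0 (w : nat -> V) (c : nat -> C) : injective c ->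
  (forall k, h (w k) = c k *: w k) -> (forall k, w k.+1 = 0 -> w k = 0) ->
  w 0%N = 0.
Proof.
move=> c_inj hw wS; apply/eqP; apply: contraT => w0.
have nz k : w k != 0 by elim: k => // k; apply: contra_neq; apply: wS.
have := eigenvectors_free c_inj hw nz (\dim {: V}).+1.
rewrite /free size_map size_rev size_iota => /eqP dimE.
by have := dimvS (subvf <<[seq w k | k <- rev (iota 0 (\dim {: V}).+1)]>>%VS);
  rewrite dimE ltnn.
Qed.

End Sl2.

(* By sl2-theory f w is a highest weight vector of weight -2. *)
Lemma sl2_lowering_eq0 (C : numFieldType) (V : vectType C) (e f h : V -> V) :
  linear e -> linear f -> linear h ->
  (forall w, e (f w) = f (e w) + h w) -> (forall w, h (f w) = f (h w) - 2 *: f w) ->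
  forall v, e v = 0 -> h v = 0 -> f v = 0.
Proof.
move=> le lf lh ef hf v ev hv.
(* The weight of f^k (f v) is - 2 - 2k. *)
pose w k := iter k f (f v); pose c k : C := - (2 * k.+1)%:R.
have f0 g : linear g -> g 0 = 0 :> V.
  by move=> lg; have := lg (-1) 0 0; rewrite scaler0 addr0 scaleN1r addNr.
have fZ (g : V -> V) a x : linear g -> g (a *: x) = a *: g x.
  by move=> lg; rewrite -[a *: x]addr0 lg f0 // addr0.
have hw k : h (w k) = c k *: w k.
  elim: k => [|k IH]; first by rewrite /= hf hv f0 // /c sub0r scaleNr.
  rewrite /= -/(w k) hf IH (fZ f) // -scalerBl; congr (_ *: _).
  by rewrite /c -opprD -natrD; congr (- _%:R); lia.
(* The rule e f^m = m (lambda - m + 1) f^(m-1) on a highest weight vector of weight lambda = - 2,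
   with m = k + 1. The coefficient is never 0, so vanishing passes from [w k.+1] to [w k]. *)
have ew k : e (w k.+1) = - ((k.+1 * k.+2)%:R) *: w k.
  elim: k => [|k IH].
    rewrite /= ef ef ev f0 // hv addr0 f0 // add0r hf hv f0 // sub0r.
    by rewrite scaleNr.
  rewrite /= ef -/(w k) -[f (w k)]/(w k.+1) IH hw (fZ f) // -[f (w k)]/(w k.+1).
  by rewrite -scalerDl /c -opprD -natrD; congr (- _%:R *: _); lia.
apply: (eigenvectors_eq0 lh (w := w) (c := c)) => // [i j|k wk].
  by move/oppr_inj/eqP; rewrite eqr_nat => /eqP; lia.
have := ew k; rewrite wk f0 // => /esym/eqP; rewrite scaler_eq0 oppr_eq0.
by rewrite pnatr_eq0 => /eqP.
Qed.

(** * The roots of T on the tensor product of C^(2n) and V *)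

Section HighestWeight.

Context (C : numFieldType) (n : nat) (V : vectType C).
Context (act : 'M[C]_(n + n) -> V -> V) (actP : lie_module (so2 C n) act).

Implicit Types (p q r s a c : 'I_(n + n)).

(** The position of an index in the order 1, ..., n, n', ..., 1'. *)
Definition position p : nat := if (p < n)%N then p : nat else ((n + n + n).-1 - p)%N.

Lemma position_lshift (j : 'I_n) : position (lshift n j) = j.
Proof. by rewrite /position /= ltn_ord. Qed.

Lemma position_rshift (j : 'I_n) : position (rshift n j) = ((n + n).-1 - j)%N.
Proof. by rewrite /position /=; case: (ltnP (n + j) n); have := ltn_ord j; lia. Qed.

Lemma position_lt p : (position p < n + n)%N.
Proof. by rewrite /position; case: (ltnP p n); have := ltn_ord p; lia. Qed.

Lemma position_inj : injective position.
Proof.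
move=> p q; rewrite /position => e; apply/val_inj => /=; move: e.
by case: (ltnP p n); case: (ltnP q n); have := ltn_ord p; have := ltn_ord q; lia.
Qed.

Lemma position_flip p : position (flip p) = ((n + n).-1 - position p)%N.
Proof.
case: (split_ordP p) => j ->; rewrite ?flip_lshift ?flip_rshift;
  by rewrite position_lshift position_rshift; have := ltn_ord j; lia.
Qed.

Context (wt : 'I_(n + n) -> C) (v : V).
Context (wt_v : forall p, act (Fmx C p p) v = wt p *: v).
Context (raise_v : forall p s, (position p < position s)%N -> s != flip p ->
  act (Fmx C p s) v = 0).
Context (v_generates : forall U : V -> Prop, submodule (so2 C n) act U ->
  U v -> forall w, U w).

(** For the sl2-triple F_(c, a), F_(a, c), F_(c, c) - F_(a, a), the vector v is a highest weight
    vector of weight [wt c - wt a], here 0. *)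
Lemma lower_eq0 c a : (position c < position a)%N -> a != flip c ->
  wt c = wt a -> act (Fmx C a c) v = 0.
Proof.
move=> ltca nac wtE; have FS r s : Fmx C r s \in so2 C n by apply: Fmx_so2.
have ac : (a == c) = false by apply: contraTF ltca => /eqP ->; rewrite ltnn.
apply: (sl2_lowering_eq0 (e := act (Fmx C c a))
  (h := fun w => act (Fmx C c c) w - act (Fmx C a a) w)).
- exact/(act_linear actP)/Fmx_so2.
- exact/(act_linear actP)/Fmx_so2.
- move=> t u w; rewrite !(actrP actP) // scalerBr opprD; exact: addrACA.
- move=> w; apply/eqP; rewrite addrC -subr_eq -(act_lie actP) // lie_FmxF.
  rewrite !eqxx (negbTE nac) eq_flip (negbTE nac) !scale0r subr0 addr0 !scale1r.
  by rewrite (actlD actP) ?memvN // (actlN actP).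
- move=> w; rewrite (actrD actP) // (actrN actP) //.
  have E1 : act (Fmx C c c) (act (Fmx C a c) w) =
      act (Fmx C a c) (act (Fmx C c c) w) - act (Fmx C a c) w.
    apply/eqP; rewrite addrC -subr_eq -(act_lie actP) // lie_FmxF.
    rewrite eqxx (negbTE nac) eq_flipF (eq_sym c) ac.
    by rewrite !scale0r addr0 scale1r subr0 sub0r (actlN actP).
  have E2 : act (Fmx C a a) (act (Fmx C a c) w) =
      act (Fmx C a c) (act (Fmx C a a) w) + act (Fmx C a c) w.
    apply/eqP; rewrite addrC -subr_eq -(act_lie actP) // lie_FmxF.
    rewrite eqxx (eq_sym c) ac eq_flipF (eq_flip c) (negbTE nac).
    by rewrite !scale0r addr0 scale1r !subr0.
  by rewrite E1 E2 opprD addrACA -opprD scaler_nat mulr2n.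
- exact: raise_v.
by rewrite !wt_v wtE subrr.
Qed.

(** The vector e_p (x) w. *)
Definition single p (w : V) : {ffun 'I_(n + n) -> V} :=
  [ffun r => (r == p)%:R *: w].

Lemma diag_single A p w : A \in so2 C n ->
  diag act A (single p w) = single p (act A w) + [ffun r => A r p *: w].
Proof.
move=> AS; apply/ffunP=> r; rewrite !ffunE (actrZ actP) //; congr (_ + _).
under eq_bigr do rewrite ffunE scalerA mulrC -scalerA.
exact: sum_delta.
Qed.

Lemma casimir_single p w : casimir act (single p w) = [ffun s => act (Fmx C p s) w].
Proof.
apply/ffunP=> s; rewrite !ffunE.
under eq_bigr do rewrite ffunE (actrZ actP) ?Fmx_so2 //.
exact: sum_delta.
Qed.

Definition lower_set p : {set 'I_(n + n)} :=
  [set s | (position s < position p)%N && (s != flip p)].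

(** The eigenvalue of T on e_p (x) v modulo the submodule generated by the e_s (x) v with s before
    p. *)
Definition casimir_root p : C := wt p - #|lower_set p|%:R.

Lemma casimir_single_hw p :
  casimir act (single p v) - casimir_root p *: single p v =
  \sum_(s in lower_set p) diag act (Fmx C p s) (single s v).
Proof.
apply/ffunP=> r; rewrite casimir_single sum_ffunE !ffunE.
have E s : s \in lower_set p -> diag act (Fmx C p s) (single s v) r =
    (s == r)%:R *: act (Fmx C p s) v + (r == p)%:R *: v.
  rewrite inE => /andP[lts nes]; rewrite diag_single ?Fmx_so2 // !ffunE.
  by rewrite FmxE eqxx (negbTE nes) mulr1 mulr0 subr0 (eq_sym s).
rewrite (eq_bigr _ E) big_split /= sumr_const.
rewrite scalerBl opprB addrA addrAC; congr (_ + _); last first.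
  by rewrite -scaler_nat scalerA mulrC -scalerA scaler_nat.
rewrite (big_mkcond) /=.
rewrite (eq_bigr (fun s => (s == r)%:R *:
    (if s \in lower_set p then act (Fmx C p s) v else 0))) => [|s _]; last first.
  by case: ifP; rewrite ?scaler0.
rewrite sum_delta inE; have [->|rp] := eqVneq r p.
  by rewrite wt_v scale1r subrr ltnn.
rewrite scale0r scaler0 subr0; have [->|rfp] := eqVneq r (flip p).
  by rewrite Fmx_flip (actl0 actP) andbF.
rewrite andbT; case: ltngtP => // [ltpr|/position_inj e]; first exact: raise_v.
by rewrite e eqxx in rp.
Qed.

(** For such a, F_(a, p') kills v by [lower_eq0] and maps e_(a') to - e_p. Hence e_p (x) v lies in
    the submodule generated by e_(a') (x) v, and a' comes before p. *)
Definition redundant p : bool :=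
  [exists a, [&& (position (flip p) < position a)%N, a != p & wt (flip p) == wt a]].

Lemma redundantP p : redundant p -> exists q A,
  [/\ A \in so2 C n, (position q < position p)%N &
      diag act A (single q v) = - single p v].
Proof.
case/existsP=> a /and3P[lta nea /eqP wtE].
exists (flip a), (Fmx C a (flip p)); split; first exact: Fmx_so2.
  have := position_flip p; have := position_flip a.
  by have := position_lt a; have := position_lt p; lia.
rewrite diag_single ?Fmx_so2 // lower_eq0 ?flipK //.
apply/ffunP=> r; rewrite !ffunE FmxE (inj_eq (@flip_inj n)) (negbTE nea).
by rewrite mulr0 sub0r flipK eqxx mulr1 scaler0 add0r scaleNr.
Qed.

(** A polynomial in T commutes with the diagonal action, so once it kills the earlier e_s (x) v it
    kills the submodule they generate. Going through the positions, a redundant p therefore costs no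
    factor, and any other p costs the factor of its own root. *)
Lemma casimir_roots : exists E : seq C,
  (forall e, e \in E -> exists2 p, ~~ redundant p & e = casimir_root p) /\
  forall y, op_prod (casimir act) E y = 0.
Proof.
have lT := casimir_linear actP.
have lP E := op_prod_linear E lT.
have P0 E : op_prod (casimir act) E 0 = 0.
  by have := lP E (-1) 0 0; rewrite scaler0 addr0 scaleN1r addNr.
have PA E A y : A \in so2 C n ->
    op_prod (casimir act) E (diag act A y) = diag act A (op_prod (casimir act) E y).
  move=> AS; symmetry; apply: op_prod_comm => [|z]; first exact: diag_linear.
  exact: casimir_diag.
have D0 A : A \in so2 C n -> diag act A 0 = 0.
  move=> AS; have := diag_linear actP AS (-1) 0 0.
  by rewrite scaler0 addr0 scaleN1r addNr.
have H N : exists E : seq C,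
    (forall e, e \in E -> exists2 p, ~~ redundant p & e = casimir_root p) /\
    forall p, (position p < N)%N -> op_prod (casimir act) E (single p v) = 0.
  elim: N => [|N [E [goodE vanE]]]; first by exists [::].
  have [p /eqP pN|noN] := pickP (fun p => position p == N); last first.
    exists E; split=> // p; rewrite ltnS leq_eqVlt => /orP[|/vanE //].
    by rewrite noN.
  have step q : (position q < N.+1)%N -> q = p \/ (position q < N)%N.
    rewrite ltnS leq_eqVlt => /orP[/eqP|]; [left | by right].
    by apply: position_inj; rewrite pN.
  have [rp|nrp] := boolP (redundant p).
    exists E; split=> // q /step[->|]; last exact: vanE.
    have [t [A [AS ltt e]]] := redundantP rp.
    rewrite -[single p v]opprK -e -scaleN1r -[_ *: _]addr0 lP P0 addr0 PA //.
    by rewrite vanE -?pN // D0 // scaler0.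
  exists (rcons E (casimir_root p)); split=> [e|q].
    by rewrite mem_rcons inE => /predU1P[->|/goodE //]; exists p.
  rewrite -cats1 op_prod_cat /=; case/step=> [->|ltq].
    rewrite casimir_single_hw linear_sum_gen // big1 // => s.
    by rewrite inE pN => /andP[lts _]; rewrite PA ?Fmx_so2 // vanE // D0 // Fmx_so2.
  rewrite addrC -scaleNr lP vanE // scaler0 add0r.
  rewrite -(op_prod_comm (T := casimir act) (f := casimir act)) //.
  by rewrite vanE // casimir0.
have [E [goodE vanE]] := H (n + n)%N; exists E; split=> // y.
suff S w p : op_prod (casimir act) E (single p w) = 0.
  have -> : y = \sum_p single p (y p).
    apply/ffunP=> r; rewrite sum_ffunE.
    under eq_bigr do rewrite ffunE.
    by rewrite sum_deltar.
  by rewrite linear_sum_gen // big1.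
(* Passing from v to all of V: the vectors w for which the polynomial kills every e_p (x) w form a
   submodule, since e_p (x) A w differs from A (e_p (x) w) by a combination of the e_r (x) w. *)
pose U w := forall p, op_prod (casimir act) E (single p w) = 0.
suff: U w by apply.
apply: v_generates => [|q]; last exact/vanE/position_lt.
have sP t u x q : single q (t *: u + x) = t *: single q u + single q x.
  by apply/ffunP=> r; rewrite !ffunE scalerDr !scalerA mulrC.
split=> [p'|t u x Uu Ux p'|A u AS Uu p'].
- suff -> : single p' 0 = 0 by exact: P0.
  by apply/ffunP=> r; rewrite !ffunE scaler0.
- by rewrite sP lP Uu Ux scaler0 addr0.
have -> : single p' (act A u) =
    diag act A (single p' u) + \sum_r (- A r p') *: single r u.
  rewrite diag_single // -[LHS]addr0 -addrA; congr (_ + _); symmetry.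
  apply/ffunP=> r; rewrite !ffunE sum_ffunE.
  under eq_bigr do rewrite ffunE [single _ _ _]ffunE scalerA mulrC -scalerA.
  by rewrite sum_deltar scaleNr subrr.
rewrite -[diag _ _ _]scale1r lP PA // Uu D0 // scaler0 add0r.
rewrite linear_sum_gen // big1 // => r _.
by rewrite -[_ *: _]addr0 lP Uu P0 scaler0 addr0.
Qed.

Lemma card_lower_lshift (j : 'I_n) : #|lower_set (lshift n j)| = j.
Proof.
rewrite -sum1_card big_split_ord /= [X in (_ + X)%N]big1 ?addn0; last first.
  move=> l; rewrite inE position_lshift position_rshift.
  by have := ltn_ord j; have := ltn_ord l; lia.
rewrite (eq_bigl (fun l : 'I_n => l < j)%N) => [|l]; last first.
  by rewrite inE !position_lshift flip_lshift eq_lrshift andbT.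
by rewrite -(big_ord_widen _ (fun=> 1%N)) ?sum1_card ?card_ord // ltnW.
Qed.

(** Of the 2n - 1 - j indices that come before, [lshift n j] is left out as the partner. *)
Lemma card_lower_rshift (j : 'I_n) : #|lower_set (rshift n j)| = ((n + n).-2 - j)%N.
Proof.
have := cardsC (lower_set (rshift n j)); rewrite card_ord.
suff -> : ~: lower_set (rshift n j) =
    lshift n j |: [set rshift n l | l : 'I_n & (l <= j)%N].
  rewrite cardsU1 card_imset; last exact: rshift_inj.
  have -> : lshift n j \notin [set rshift n l | l : 'I_n & (l <= j)%N].
    by apply/imsetP=> [[l _ /eqP]]; rewrite eq_lrshift.
  have -> : #|[set l : 'I_n | (l <= j)%N]| = j.+1.
    rewrite -sum1_card (eq_bigl (fun l : 'I_n => l < j.+1)%N) => [|l];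
      last by rewrite inE.
    by rewrite -(big_ord_widen _ (fun=> 1%N)) ?sum1_card ?card_ord.
  by have := ltn_ord j; lia.
apply/setP=> s; rewrite !inE negb_and negbK flip_rshift position_rshift orbC.
congr (_ || _); have := ltn_ord j.
case: (split_ordP s) => l -> ltj; have := ltn_ord l => ltl.
  rewrite position_lshift; apply/idP/imsetP; first by lia.
  by case=> l' _ /eqP; rewrite eq_lrshift.
rewrite position_rshift; apply/idP/imsetP => [lj|[l' + /rshift_inj ->]].
  by exists l; rewrite // inE; lia.
by rewrite inE; lia.
Qed.

End HighestWeight.

(** * The excluded values of b *)

Section Weights.

Context (C : numFieldType) (n : nat) (mu : n.-tuple C).
Context (n_gt1 : (1 < n)%N) (mu_dom : dominant_integral mu).

Lemma dominant_diff i j : (i <= j)%N -> (j < n)%N ->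
  exists k : nat, mu`_i - mu`_j = k%:R.
Proof.
have [_ mud _] := mu_dom; elim: j => [|j IH].
  by rewrite leqn0 => /eqP -> _; exists 0%N; rewrite subrr.
rewrite leq_eqVlt => /orP[/eqP -> _|]; first by exists 0%N; rewrite subrr.
rewrite ltnS => leij ltjn; have [k kE] := IH leij (ltnW ltjn).
have [l lE] := mud j ltjn; exists (k + l)%N.
by rewrite natrD -kE -lE addrA subrK.
Qed.

Lemma dominant_half j : (j.+1 < n)%N -> exists k : nat, mu`_j = k%:R / 2.
Proof.
move=> ltjn; have [_ _ [k kE]] := mu_dom.
have [a aE] := @dominant_diff n.-2 n.-1 ltac:(lia) ltac:(lia).
have [c cE] := @dominant_diff j n.-2 ltac:(lia) ltac:(lia).
(* Twice mu_j is twice its difference to the last but one coordinate, plus the difference and the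
   sum of the last two coordinates. So only the last coordinate can be negative. *)
exists (c + c + a + k)%N; by rewrite !natrD -kE -aE -cE; field.
Qed.

Lemma dominant_last :
  (exists k : nat, mu`_n.-1 = k%:R / 2) \/
  (0 < - mu`_n.-1 /\ exists k : nat, - mu`_n.-1 = k%:R / 2).
Proof.
have [half _ _] := mu_dom; have [[k|k] ->] := half n.-1 ltac:(lia).
  by left; exists k.
right; rewrite NegzE mulrNz mulNr opprK divr_gt0 ?ltr0n //.
by split=> //; exists k.+1.
Qed.

Context (s : nat) (ns : s.+1.-tuple nat) (levels : level_sequence mu ns).

Let level1_bounds : (0 < s)%N /\ (0 < nth 0%N ns 1 <= n)%N.
Proof.
have [ns0 nsn srt _] := levels.
have s_gt0 : (0 < s)%N.
  case: (posnP s) => // s0; have := n_gt1.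
  by rewrite -nsn (congr1 (nth 0%N ns) s0) ns0.
have lt1 := sorted_ltn_nth ltn_trans 0%N srt.
split=> //; apply/andP; split.
  by rewrite -{1}ns0; apply: lt1; rewrite ?inE ?size_tuple //; lia.
case: (ltngtP 1 s) => [s1||e]; last first.
- by rewrite -[X in (_ <= X)%N]nsn -(congr1 (nth 0%N ns) e).
- by lia.
by rewrite -nsn ltnW // lt1 ?inE ?size_tuple //; lia.
Qed.

Lemma level0_eq i j : (i < nth 0%N ns 1)%N -> (j < nth 0%N ns 1)%N -> mu`_i = mu`_j.
Proof.
have [ns0 _ _ lev] := levels; have [s_gt0 /andP[_ n1]] := level1_bounds.
move=> i1 j1; apply/lev; try lia.
by exists 0%N; split; rewrite ?ns0.
Qed.

(** If the first level ended before n - 1, the last two coordinates would share the second level;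
    being opposite, they could not both be positive. *)
Lemma special_level : mu`_n.-2 = - mu`_n.-1 -> 0 < - mu`_n.-1 -> s = 2%N ->
  nth 0%N ns 1 = n.-1.
Proof.
have [ns0 nsn srt lev] := levels => e pos s2.
have nsn2 : nth 0%N ns 2 = n by rewrite -nsn (congr1 (nth 0%N ns) s2).
have n1 : (nth 0%N ns 1 < n)%N.
  rewrite -[X in (_ < X)%N]nsn2; apply: (sorted_ltn_nth ltn_trans 0%N srt) => //;
    by rewrite inE size_tuple s2.
apply/eqP; rewrite eqn_leq; apply/andP; split; first by lia.
rewrite leqNgt; apply/negP => lt1.
have : mu`_n.-2 = mu`_n.-1.
  apply/lev; try lia.
  by exists 1%N; rewrite nsn2; split; lia.
rewrite e => e'; have pos' := pos; rewrite e' in pos'.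
by have := addr_gt0 pos pos'; rewrite addNr ltxx.
Qed.

(** A nonnegative half-integral mu_j puts b into n - 1 - 1/2 N. There remains a negative last
    coordinate, where b = n - 1 + |mu_n| - k. As |mu_n| is at most mu_1 this lies in Theta, and when
    |mu_n| = mu_1 in the special case it is the first form of Theta. *)
Lemma excluded_lower (j : 'I_n) k b : b = j%:R - k%:R - mu`_j ->
  minus_halfN (n%:R - 1) b \/ Theta mu ns b.
Proof.
move=> bE; have ltj := ltn_ord j.
case: (ltnP j.+1 n) => [ltjn|lenj].
  left; have [t tE] := dominant_half ltjn; exists (2 * (n.-1 - j + k) + t)%N.
  rewrite bE tE natrD natrM natrD natrB; last by lia.
  by rewrite -subn1 natrB; [field | lia].
have jE : (j : nat) = n.-1 by lia.
have jC : (j : nat)%:R = n%:R - 1 :> C by rewrite jE -subn1 natrB //; lia.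
have [[t tE]|[pos [t tE]]] := dominant_last.
  left; exists (2 * k + t)%N.
  by rewrite bE jC jE tE [(2 * k + t)%:R]natrD natrM; field.
right; have [_ _ [c cE]] := mu_dom.
have [a aE] := @dominant_diff 0 n.-2 ltac:(lia) ltac:(lia).
case: (boolP [&& mu`_n.-2 == - mu`_n.-1, 0 < - mu`_n.-1 & s == 2%N]) => [sp|nsp].
  rewrite /Theta sp; case/and3P: sp => /eqP e _ /eqP s2.
  have n1 := special_level e pos s2.
  have -> : mu`_0 = mu`_n.-2 by apply: level0_eq; lia.
  by exists k; rewrite bE jC jE e; ring.
rewrite /Theta (negbTE nsp); have [_ /andP[_ n1]] := level1_bounds.
exists (a + c + (n - nth 0%N ns 1) + k)%N.
rewrite mul2n -addnn !natrD natrB // -cE -aE bE jC jE; ring.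
Qed.

(** The first hypothesis makes j the last index of its level, so j + 1 >= n_1, and mu_j <= mu_1
    gives the second form of Theta. In the special case only the last two indices are possible. The
    last but one is ruled out by the second hypothesis, its weight being opposite to the last; for
    the last, mu_n < 0 puts b into n - 1 - 1/2 N. This is why Theta is smaller there. *)
Lemma excluded_upper (j : 'I_n) k b :
  (forall l, (j < l < n)%N -> mu`_j != mu`_l) ->
  (forall l : 'I_n, l != j -> mu`_j != - mu`_l) ->
  b = mu`_j + (n + n)%:R - 2 - j%:R - k%:R ->
  minus_halfN (n%:R - 1) b \/ Theta mu ns b.
Proof.
move=> nred1 nred2 bE; have ltj := ltn_ord j.
have [_ /andP[n1_gt0 n1]] := level1_bounds.
have lej : (nth 0%N ns 1 <= j.+1)%N.
  rewrite leqNgt; apply/negP => lt1; have /eqP := nred1 j.+1 ltac:(lia).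
  by apply; apply: level0_eq; lia.
case: (boolP [&& mu`_n.-2 == - mu`_n.-1, 0 < - mu`_n.-1 & s == 2%N]) => [sp|nsp].
  case/and3P: sp => /eqP e pos /eqP s2; left.
  have nE := special_level e pos s2.
  have jE : (j : nat) = n.-1.
    case: (ltnP j.+1 n) => [ltjn|]; last by lia.
    have je : (j : nat) = n.-2 by lia.
    have ln : (n.-1 < n)%N by lia.
    have /eqP := nred2 (Ordinal ln) ltac:(apply/eqP => /(congr1 val) /=; lia).
    by case; rewrite /= je e.
  have jC : (j : nat)%:R = n%:R - 1 :> C by rewrite jE -subn1 natrB //; lia.
  have [[t tE]|[_ [t tE]]] := dominant_last.
    move: pos; rewrite tE oppr_gt0.
    move/(le_lt_trans (divr_ge0 (ler0n C t) (ler0n C 2))).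
    by rewrite ltxx.
  exists (2 * k + t)%N.
  by rewrite bE jC jE -[mu`__]opprK tE [(2 * k + t)%:R]natrD natrM natrD; field.
right; rewrite /Theta (negbTE nsp).
have [a aE] := @dominant_diff 0 j ltac:(lia) ltac:(lia).
exists (a + (j.+1 - nth 0%N ns 1) + k)%N.
by rewrite mul2n -addnn !natrD natrB // -aE bE -[j.+1]addn1 !natrD; ring.
Qed.

End Weights.

(** * Irreducibility *)

Section Irreducibility.

Context (C : numFieldType) (n : nat) (V : vectType C).
Context (act : 'M[C]_(n + n) -> V -> V) (b : C).
Context (actP : lie_module (so2 C n) act).
Context (act_irr : forall K, submodule (so2 C n) act K ->
  (forall v, K v -> v = 0) \/ (forall v, K v)).
Context (E : seq C) (E_van : forall y, op_prod (casimir act) E y = 0).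
Context (E_b : forall e (k : nat), e \in E -> b != - k%:R - e).
Context (half_b : forall k : nat, b != n%:R - 1 - k%:R / 2).

Local Notation X := (tensor (n + n) V).
Local Notation rho := (conformal act b).
Local Notation p := (pivot n).

Context (U : X -> Prop) (U_sub : submodule (so2 C n.+1) rho U).

Let U0 : U 0. Proof. by case: U_sub. Qed.

Let UP a u w : U u -> U w -> U (a *: u + w).
Proof. by case: U_sub => _ + _; apply. Qed.

Let Urho r s w : U w -> U (rho (Fmx C r s) w).
Proof. by case: U_sub => _ _ h Uw; apply/h/Uw/Fmx_so2. Qed.

Let UZ a w : U w -> U (a *: w).
Proof. by move=> Uw; rewrite -[_ *: _]addr0; apply: UP. Qed.

Let UD u w : U u -> U w -> U (u + w).
Proof. by move=> Uu Uw; rewrite -[u]scale1r; apply: UP. Qed.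

Let UN w : U w -> U (- w).
Proof. by move=> Uw; rewrite -scaleN1r; apply: UZ. Qed.

Let US I (r : seq I) (P : pred I) (F : I -> X) :
  (forall i, P i -> U (F i)) -> U (\sum_(i <- r | P i) F i).
Proof. by move=> UF; apply: (big_ind U). Qed.

Let UZ_inv a w : a != 0 -> U (a *: w) -> U w.
Proof. by move=> a0 /(UZ a^-1); rewrite scalerA mulVf // scale1r. Qed.

Let Ud i w : U w -> U (conf_d i w).
Proof. by move=> Uw; rewrite -(conformal_d act b); apply: Urho. Qed.

Let U_const_ex w : U w -> w != 0 -> exists2 v : V, v != 0 & U (pure 1 v).
Proof.
elim/conf_d_ind: w => [|w IH Uw nz]; first by rewrite eqxx.
case: (pickP (fun i => conf_d i w != 0)) => [i|d0]; first exact/IH/Ud.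
have we : w = pure 1 (const_term w).
  by apply: conf_d_eq0 => i; apply/eqP; have /negbFE := d0 i.
exists (const_term w); last by rewrite -we.
by apply: contra_neq nz => c0; rewrite we c0 pure0r.
Qed.

(** As L_(i, j) acts on 1 (x) v as 1 (x) F_(i, j) v, the vectors v with 1 (x) v in U form an
    o(2n)-submodule of V. *)
Let U_const : (exists2 w, U w & w != 0) -> forall v, U (pure 1 v).
Proof.
case=> w Uw /(U_const_ex Uw)[v nzv Uv].
have [K0|//] : (forall v, U (pure 1 v) -> v = 0) \/ (forall v, U (pure 1 v)).
  apply: act_irr; split=> [|a u x Uu Ux|A u AS Uu]; first by rewrite pure0r.
    by rewrite pureDr pureZr; apply: UP.
  have FS r s : Fmx C r s \in so2 C n by apply: Fmx_so2.
  rewrite (so2_sum (so2_antisym AS)) (actlZ actP); last first.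
    by do 2![apply: memv_suml => ? _]; apply: memvZ.
  rewrite pureZr; apply: UZ; rewrite (actl_sum actP) => [|r _]; last first.
    by apply: memv_suml => ? _; apply: memvZ.
  rewrite pure_sumr; apply: US => r _.
  rewrite (actl_sum actP) => [|s _]; last exact: memvZ.
  rewrite pure_sumr; apply: US => s _; rewrite (actlZ actP) // pureZr; apply: UZ.
  have : U (conf_L act r s (pure 1 u)) by rewrite -(conformal_L actP b); apply: Urho.
  rewrite conf_L_pure // /opL -mpolyC1 !mderivC !mulr0 subr0 pure0 add0r.
  by [].
by case/eqP: nzv; apply: K0.
Qed.

(** The map [th] identifies C^(2n) (x) V with the elements of degree 1. Summing J_i (1 (x) y_i) over
    i gives [th] of T y + b y, so T acts as - b modulo U, and a polynomial that annihilates T but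
    not - b forces U to contain degree 1. *)
Let U_linear (Uc : forall v, U (pure 1 v)) i v : U (pure 'X_i v).
Proof.
pose th (y : {ffun 'I_(n + n) -> V}) : X := \sum_i pure 'X_i (y i).
have thP a y z : th (a *: y + z) = a *: th y + th z.
  rewrite /th scaler_sumr -big_split; apply: eq_bigr => j _ /=.
  by rewrite !ffunE pureDr pureZr.
have thT y : U (th (casimir act y) + b *: th y).
  suff -> : th (casimir act y) + b *: th y =
      \sum_i conf_J act b i (pure 1 (y i)).
    by apply: US => j _; rewrite -[conf_J _ _ _ _]opprK -conformal_J //;
       apply/UN/Urho/Uc.
  under eq_bigr do rewrite conf_J_pure //.
  rewrite big_split /= [LHS]addrC; congr (_ + _).
    rewrite /th scaler_sumr; apply: eq_bigr => j _; rewrite -pureZ mulr1.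
    congr (pure _ _); rewrite /opJ /opD -mpolyC1.
    rewrite big1 => [|r _]; last by rewrite mderivC mulr0.
    by rewrite mderivC !mulr0 subrr add0r.
  rewrite exchange_big; apply: eq_bigr => j _ /=.
  by rewrite ffunE pure_sumr; apply: eq_bigr => r _; rewrite mulr1.
have th0 : th 0 = 0 by rewrite /th big1 // => j _; rewrite ffunE pure0r.
have thZ a y : th (a *: y) = a *: th y by rewrite -[_ *: y]addr0 thP th0 addr0.
pose y : {ffun 'I_(n + n) -> V} := [ffun r => (r == i)%:R *: v].
have H : U (th (op_prod (casimir act) E y - (\prod_(e <- E) (- b - e)) *: y)).
  apply: (@op_prod_mod _ _ (casimir act) E (fun y => U (th y)) (- b) y) => //.
  - exact: casimir_linear.
  - by rewrite th0.
  - by move=> a x z Ux Uz; rewrite thP; apply: UP.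
  - move=> x Ux; have := UP (- b) Ux (thT x).
    by rewrite scaleNr addrCA addNr addr0.
  by rewrite scaleNr opprK addrC thP addrC; apply: thT.
move: H; rewrite E_van sub0r -scaleNr thZ => H.
have -> : pure 'X_i v = th y.
  rewrite /th (bigD1 i) //= ffunE eqxx scale1r big1 ?addr0 // => j /negbTE ne.
  by rewrite ffunE ne scale0r pure0r.
apply: UZ_inv H; rewrite oppr_eq0 prodf_seq_neq0; apply/allP => e eE /=.
have := E_b 0 eE; rewrite oppr0 sub0r; apply: contra_neq => h.
by rewrite -[b]opprK; congr (- _); apply/eqP; rewrite -subr_eq0 h.
Qed.

Let U_step w N : (1 < N)%N -> conf_D b w = (b + N%:R) *: w ->
  (forall i, U (conf_d i w)) -> U w.
Proof.
move=> N1 Dw dw.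
pose y : {ffun 'I_(n.+1 + n.+1) -> X} := [ffun r => (r == p)%:R *: w].
pose S (z : {ffun 'I_(n.+1 + n.+1) -> X}) := forall r, U (z r).
pose c := - (b + N%:R).
have rhoP := conformal_lie_module b actP.
have subZE (u z : {ffun 'I_(n.+1 + n.+1) -> X}) a r : (u - a *: z) r = u r - a *: z r.
  by rewrite !ffunE.
pose s := (b - (n + n)%:R) :: [seq e - 1 | e <- E] ++ [:: - b].
have H : S (op_prod (casimir rho) s y - (\prod_(e <- s) (c - e)) *: y).
  apply: (@op_prod_mod _ _ (casimir rho) s S c y); first exact: casimir_linear.
  - by move=> r; rewrite ffunE.
  - by move=> a u z Su Sz r; rewrite !ffunE; apply: UP.
  - by move=> z Sz r; rewrite ffunE; apply: US => q _; apply: Urho.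
  (* Modulo U, e_p (x) w is an eigenvector of Q: the component of its image at r is hatF_(p, r) w,
     which is d_j w in U at kappa j, - D w at p, and 0 at p'. *)
  have Qy r : casimir rho y r = rho (Fmx C p r) w.
    rewrite ffunE (bigD1 p) //= ffunE eqxx scale1r big1 ?addr0 // => q /negbTE ne.
    by rewrite ffunE ne scale0r (actr0 rhoP) ?Fmx_so2.
  move=> r; rewrite subZE Qy [y r]ffunE.
  case: (kappa_pivotE r) => [[j ->] | -> | ->].
  - by rewrite pivotE scale0r scaler0 subr0 conformal_d.
  - rewrite eqxx scale1r conformal_D Dw /c scaleNr subrr; exact: U0.
  rewrite pivotE scale0r scaler0 subr0 Fmx_flip (actl0 rhoP); exact: U0.
have := H p; rewrite subZE conformal_casimir // [y _]ffunE eqxx scale1r.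
rewrite ffunE sub0r -scaleNr; apply: UZ_inv.
rewrite oppr_eq0 prodf_seq_neq0; apply/allP => e; rewrite inE mem_cat /c /= => he.
case/or3P: he => [/eqP -> | /mapP[f fIn ->] | ].
(* Here c = b - 2n means b = n - N/2 = n - 1 - (N - 2)/2, an excluded value because N >= 2. *)
- have := half_b (N - 2)%N; apply: contra_neq => h.
  rewrite natrB //; have -> : b = n%:R - N%:R / 2 +
      (- (b + N%:R) - (b - (n + n)%:R)) / (- 2).
    by rewrite natrD; field.
  by rewrite h; field.
(* The shift of the roots by 1 turns the degree N into N - 1. *)
- have := E_b N.-1 fIn; apply: contra_neq => h.
  have -> : b = - N.-1%:R - f - (- (b + N%:R) - (f - 1)).
    by rewrite -subn1 natrB ?(ltnW N1) //; ring.
  by rewrite h subr0.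
rewrite inE => /eqP ->; rewrite opprK opprD addrC addrA subrr sub0r oppr_eq0.
by rewrite pnatr_eq0; case: (N) N1.
Qed.

Let U_monomial (Uc : forall v, U (pure 1 v)) (u : 'X_{1..n + n}) v :
  U (pure 'X_[u] v).
Proof.
have [N] := ubnP (mdeg u); elim: N u v => // N IH u v; rewrite ltnS => leN.
have [/eqP|u0] := eqVneq (mdeg u) 0%N.
  by rewrite mdeg_eq0 => /eqP ->; rewrite mpolyX0.
have ud i : U (conf_d i (pure 'X_[u] v)).
  rewrite conf_d_pure mderivX pureZ.
  have [->|ui] := eqVneq (u i) 0%N; first by rewrite scale0r.
  apply/UZ/IH; apply: leq_trans leN.
  have {2}-> : u = (u - U_(i) + U_(i))%MM by rewrite submK ?lep1mP.
  by rewrite mdegD mdeg1 addn1.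
have [u1|un1] := eqVneq (mdeg u) 1%N.
  have /existsP[i /eqP ->] : [exists i, u == U_(i)%MM] by rewrite -mdeg_eq1 u1.
  exact: U_linear.
apply: (@U_step _ (mdeg u)) => //; first by lia.
by rewrite conf_D_pure opD_monomial -scalerDl pureZ addrC.
Qed.

Lemma submodule_full : (exists2 w, U w & w != 0) -> forall w, U w.
Proof.
move=> /U_const Uc; elim/tensor_ind => [u w|g v]; first exact: UD.
rewrite (mpolyE g).
have -> : pure (\sum_(m <- msupp g) g@_m *: 'X_[m]) v =
    \sum_(m <- msupp g) g@_m *: pure 'X_[m] v :> X.
  elim: (msupp g) => [|m r IH]; first by rewrite !big_nil pure0.
  by rewrite !big_cons pureD pureZ IH.
by apply: US => m _; apply/UZ/U_monomial.
Qed.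

End Irreducibility.

(** * The roots of T for V(mu) *)

Section HighestWeightOfMu.

Context (C : numFieldType) (n : nat) (mu : n.-tuple C).

(** The eigenvalue of F_(q, q) on the highest weight vector; the sign comes from F_(j', j') = -
    F_(j, j). *)
Definition index_weight (q : 'I_(n + n)) : C :=
  match split q with inl j => mu`_j | inr j => - mu`_j end.

Lemma index_weight_lshift (j : 'I_n) : index_weight (lshift n j) = mu`_j.
Proof.
by rewrite /index_weight -[lshift n j]/(unsplit (inl j)) unsplitK.
Qed.

Lemma index_weight_rshift (j : 'I_n) : index_weight (rshift n j) = - mu`_j.
Proof.
by rewrite /index_weight -[rshift n j]/(unsplit (inr j)) unsplitK.
Qed.

(** In the order 1, ..., n, n', ..., 1' the positive root vectors are upper triangular: the root is
    a difference for two indices of the same half and a sum for j before l'. An index j' never comes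
    before an l. *)
Lemma raising_root (q r : 'I_(n + n)) : (position q < position r)%N ->
  r != flip q ->
  exists2 alpha, positive_root alpha & root_vector alpha (Fmx C q r).
Proof.
move=> ltqr nrq.
have lieH k : lie (Hmx C k) (Fmx C q r) =
    ((lshift n k == q)%:R - (lshift n k == flip q)%:R - (lshift n k == r)%:R
     + (lshift n k == flip r)%:R) *: Fmx C q r.
  have E (P : bool) (A : 'M[C]_(n + n)) :
      (P -> A = Fmx C q r) -> P%:R *: A = P%:R *: Fmx C q r.
    by case: P => [->|_] //; rewrite !scale0r.
  rewrite /Hmx lie_FmxF (E (_ == q)) => [|/eqP -> //].
  rewrite (E (q == _)) => [|/eqP -> //].
  rewrite (E (r == lshift n k)) => [|/eqP -> //].
  rewrite (E (r == _)) => [|/eqP -> //].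
  rewrite (eq_flip q) (eq_flip r) (eq_sym r).
  by rewrite -!scalerBl -scalerDl.
suff [alpha pos aE] : exists2 alpha, positive_root alpha & forall k : 'I_n,
    (lshift n k == q)%:R - (lshift n k == flip q)%:R - (lshift n k == r)%:R
     + (lshift n k == flip r)%:R = alpha k :> C.
  by exists alpha => //; split=> [|k]; rewrite ?Fmx_so2 // lieH aE.
move: ltqr nrq; case: (split_ordP q) => j ->; case: (split_ordP r) => l ->;
  rewrite ?flip_lshift ?flip_rshift ?position_lshift ?position_rshift.
- move=> ltjl _; exists (eps C j - eps C l).
    by exists j, l; split=> //; right.
  by move=> k; rewrite !ffunE !eq_lshift !eq_lrshift !(eq_sym k) subr0 addr0.
- move=> _; rewrite eq_rshift => nlj.
  exists (eps C j + eps C l).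
    case: (ltngtP j l) => [ltjl|ltlj|/val_inj e]; last by rewrite e eqxx in nlj.
      by exists j, l; split=> //; left.
    by exists l, j; split=> //; left; rewrite addrC.
  by move=> k; rewrite !ffunE !eq_lshift !eq_lrshift !(eq_sym k) !subr0.
- by move=> lt _; have := ltn_ord j; have := ltn_ord l; lia.
move=> lt _; exists (eps C l - eps C j).
  exists l, j; split; last by right.
  by have := ltn_ord j; have := ltn_ord l; lia.
move=> k; rewrite !ffunE !eq_lshift !eq_lrshift !(eq_sym k) sub0r subr0.
by rewrite addrC.
Qed.

Context (V : vectType C) (act : 'M[C]_(n + n) -> V -> V).

Lemma simple_casimir_roots : simple_highest_weight_module act mu ->
  exists E : seq C,
    (forall e, e \in E -> exists2 q, ~~ redundant index_weight q &
                             e = casimir_root index_weight q) /\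
    forall y, op_prod (casimir act) E y = 0.
Proof.
case=> [[actP _ irr] [v [nzv Hv Xv]]].
apply: (@casimir_roots _ _ _ act actP index_weight v).
- move=> q; case: (split_ordP q) => j ->.
    by rewrite index_weight_lshift -Hv.
  rewrite index_weight_rshift -flip_lshift FmxN (actlN actP) ?Fmx_so2 //.
  by rewrite scaleNr -Hv.
- by move=> q r ltqr nrq; have [alpha pos rv] := raising_root ltqr nrq;
    exact: Xv pos rv.
move=> K Ksub Kv; have [K0|//] := irr K Ksub.
by case/eqP: nzv; apply: K0.
Qed.

(** With indices counted from 0, the roots are mu_j - j and - mu_j - (2n - 2 - j). For j',
    non-redundancy says that mu_j differs from the weight of every index after j other than j',
    which yields both hypotheses of [excluded_upper]. *)
Lemma casimir_root_excluded s (ns : s.+1.-tuple nat) q (k : nat) b :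
  (1 < n)%N -> dominant_integral mu -> level_sequence mu ns ->
  ~~ redundant index_weight q ->
  b = - k%:R - casimir_root index_weight q ->
  minus_halfN (n%:R - 1) b \/ Theta mu ns b.
Proof.
move=> n1 dom lev; case: (split_ordP q) => j -> nred ->; rewrite /casimir_root.
  rewrite index_weight_lshift card_lower_lshift.
  by apply: (excluded_lower n1 dom lev (j := j) (k := k)); ring.
rewrite index_weight_rshift card_lower_rshift.
have {}nred r : (j < position r)%N -> r != rshift n j -> mu`_j != index_weight r.
  move=> ltjr ne; apply: contra nred => e; apply/existsP; exists r.
  by rewrite flip_rshift position_lshift ltjr ne index_weight_lshift.
apply: (excluded_upper n1 dom lev (j := j) (k := k)).
- move=> l /andP[ltjl ltln]; have := nred (lshift n (Ordinal ltln)).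
  by rewrite index_weight_lshift position_lshift eq_lrshift; apply.
- move=> l nlj; have := nred (rshift n l).
  rewrite index_weight_rshift position_rshift eq_rshift; apply=> //.
  by have := ltn_ord j; have := ltn_ord l; lia.
rewrite natrB; last by have := ltn_ord j; lia.
by rewrite -subn2 natrB; [ring | lia].
Qed.

End HighestWeightOfMu.

Local Open Scope complex_scope.

Theorem theorem2p6 (R : realType) (n : nat) (mu : n.-tuple R[i])
    (s : nat) (ns : s.+1.-tuple nat)
    (V : vectType R[i]) (act : 'M[R[i]]_(n + n) -> V -> V) (b : R[i]) :
  (1 < n)%N ->
  dominant_integral mu ->
  (exists i : 'I_n, mu`_i != 0) ->
  level_sequence mu ns ->
  simple_highest_weight_module act mu ->
  ~ (minus_halfN (n%:R - 1) b \/ Theta mu ns b) ->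
  irreducible_module (so2 R[i] n.+1) (conformal act b).
Proof.
move=> n1 dom _ lev hw nb; have [E [goodE vanE]] := simple_casimir_roots hw.
have [[actP _ irr] [v [nzv _ _]]] := hw.
split=> [||U Usub]; first exact: conformal_lie_module.
  exists (pure 1 v); apply: contra_neq nzv => e.
  by have := const_term_pure (m := n + n) 1 v; rewrite e linear0 mcoeff1 eqxx scale1r.
(* A submodule is an arbitrary predicate, so whether it has a nonzero element is decided
   classically. *)
case: (classic (exists2 w, U w & w != 0)) => [exU|noU].
  right; apply: (submodule_full actP irr vanE _ _ Usub exU) => [e k eE|k].
    apply/eqP => be; apply: nb; have [q nred eq] := goodE e eE.
    by apply: (casimir_root_excluded n1 dom lev nred (k := k)); rewrite -eq.
  by apply/eqP => be; apply: nb; left; exists k.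
by left=> w Uw; apply/eqP/negP => /negP w0; apply: noU; exists w.
Qed.
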